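(* Let $\Omega\subset\mathbb{R}^n$ be an open, bounded domain with outward unit normal $\nu$ on $\partial\Omega$, and let $u\in C^2(\Omega)\cap C^1(\overline{\Omega})$ be such that $\frac{\partial u}{\partial\nu}\ge\alpha>0$ on $\partial\Omega$, where $\alpha$ is a constant. Assume that $$\|\Delta u\|_{L^n(\Omega)}=n\,\alpha\,|B_1|^{1/n}.$$ Then there are $c_0\in\mathbb{R}$ and $x_0\in\mathbb{R}^n$ such that $u(x)=c_0|x-x_0|^2$ and $\Omega$ is a ball centered at $x_0$.
   Context: $B_1$ is the unit ball of $\mathbb{R}^n$ and $|B_1|$ its Lebesgue measure; $\frac{\partial u}{\partial\nu}=\nabla u\cdot\nu$ on $\partial\Omega$. (The inequality $\|\Delta u\|_{L^n(\Omega)}\ge n\alpha|B_1|^{1/n}$ holds for every such $u$; the assumption is that equality occurs.)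
   Formalization: Proved for n ≥ 2 and with u(x) = c_0|x-x_0|^2 + c_1: for n = 1 the claim fails (Ω = (-1,1), u = x^4/4, α = 1), and an additive constant must be allowed since the hypotheses involve only derivatives of u (u = |x|^2/2 + 1 on B_1). *)

(* Defs.v *)
From HB Require Import structures.
From mathcomp Require Import all_boot all_order all_algebra.
From mathcomp Require Import all_classical all_reals all_analysis.

Set Implicit Arguments.
Unset Strict Implicit.
Unset Printing Implicit Defensive.

Import Order.TTheory GRing.Theory Num.Theory.
Import numFieldNormedType.Exports.

Local Open Scope classical_set_scope.
Local Open Scope ring_scope.

(* R^n is 'rV[R]_n.  Its library norm `|x| is the sup norm: it has the right
   topology, bounded sets and derivatives, but lengths and balls must use the
   Euclidean norm. *)
Section euclidean.
Context {R : realType} {n : nat}.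
Implicit Types (x y : 'rV[R]_n) (r : R).

Definition dotv x y : R := \sum_(i < n) x 0 i * y 0 i.

Definition enorm x : R := Num.sqrt (dotv x x).

Definition eball x r : set 'rV[R]_n := [set y | enorm (y - x) < r].

End euclidean.

Definition rV_display : measure_display -> measure_display.
Proof. exact. Qed.

(* The sigma-algebra generated by the coordinates, i.e. the Borel
   sigma-algebra of R^n. *)
Section measurable_rV.
Context {R : realType} {n : nat}.

Let coors : 'I_n -> 'rV[R]_n -> R := fun i x => x 0 i.

Let rV_set0 : g_sigma_preimage coors set0.
Proof. exact: sigma_algebra0. Qed.

Let rV_setC A : g_sigma_preimage coors A -> g_sigma_preimage coors (~` A).
Proof. exact: sigma_algebraC. Qed.

Let rV_bigcup (F : (set 'rV[R]_n)^nat) :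
  (forall i, g_sigma_preimage coors (F i)) ->
  g_sigma_preimage coors (\bigcup_i (F i)).
Proof. exact: sigma_algebra_bigcup. Qed.

HB.instance Definition _ := @isMeasurable.Build
  (rV_display R.-ocitv.-measurable.-sigma) 'rV[R]_n (g_sigma_preimage coors) rV_set0 rV_setC rV_bigcup.

End measurable_rV.

Section lebesgue.
Context {R : realType}.
Local Open Scope ereal_scope.

Definition rV_cons n (p : R * 'rV[R]_n) : 'rV[R]_(1 + n) :=
  row_mx (p.1)%:M p.2.

Lemma measurable_coord n (i : 'I_n) :
  measurable_fun [set: 'rV[R]_n] (fun x : 'rV[R]_n => x 0%R i).
Proof.
move=> _ Y mY; rewrite setTI; apply: sub_sigma_algebra => /=.
rewrite -bigcup_seq/=; exists i => /=; first by rewrite mem_index_enum.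
by exists Y => //; rewrite setTI.
Qed.

Lemma measurable_fun_rVP d (T : measurableType d) n (f : T -> 'rV[R]_n) :
  measurable_fun [set: T] f <->
  forall i, measurable_fun [set: T] (fun t => f t 0%R i).
Proof.
split=> [mf i|mf].
  exact: (measurableT_comp (measurable_coord i)).
suff : g_sigma_preimage (fun (i : 'I_n) (x : 'rV[R]_n) => x 0%R i) `<=`
       image_set_system [set: T] f measurable.
  by move=> H _ Y /H; rewrite /image_set_system/= setTI.
apply: smallest_sub.
  exact: sigma_algebra_image (@sigma_algebra_measurable _ T).
rewrite -bigcup_seq; apply: bigcup_sub => i _ A [B mB <-].
rewrite /image_set_system/= !setTI -comp_preimage.
by have := mf i measurableT B mB; rewrite setTI.
Qed.

Lemma measurable_rV_cons n : measurable_fun [set: R * 'rV[R]_n] (@rV_cons n).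
Proof.
apply/measurable_fun_rVP => i; rewrite /rV_cons.
under eq_fun do rewrite mxE.
case: (fintype.split i) => j.
  under eq_fun do rewrite mxE ord1 mulr1n.
  exact: measurable_fst.
exact: (measurableT_comp (measurable_coord j)).
Qed.

Definition rV_uncons n (x : 'rV[R]_(1 + n)) : R * 'rV[R]_n :=
  (x 0%R 0%R, rsubmx x).

Lemma rV_consK n : cancel (@rV_cons n) (@rV_uncons n).
Proof.
move=> [a x]; rewrite /rV_uncons /rV_cons row_mxKr; congr (_, _).
have -> : 0%R = lshift n ord0 :> 'I_(1 + n) by apply/val_inj.
by rewrite row_mxEl ord1 mxE mulr1n.
Qed.

Lemma measurable_rV_uncons n :
  measurable_fun [set: 'rV[R]_(1 + n)] (@rV_uncons n).
Proof.
apply/measurable_fun_pairP; split; first exact: measurable_coord.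
apply/measurable_fun_rVP => i; rewrite /rV_uncons.
under eq_fun do rewrite /= mxE.
exact: measurable_coord.
Qed.

Section lebesgue_cons.
Context {n : nat} (mu : {sigma_finite_measure set 'rV[R]_n -> \bar R}).

Definition leb_cons : set 'rV[R]_(1 + n) -> \bar R :=
  pushforward (@lebesgue_measure R \x mu) (@rV_cons n).

Let leb_cons0 : leb_cons set0 = 0.
Proof. by rewrite /leb_cons /pushforward preimage_set0 measure0. Qed.

Let leb_cons_ge0 A : 0 <= leb_cons A.
Proof. by rewrite /leb_cons /pushforward; exact: measure_ge0. Qed.

Let leb_cons_sigma_additive : semi_sigma_additive leb_cons.
Proof.
exact: (@measure_semi_sigma_additive _ _ _
  (@measure_function_pushforward__canonical__measure_function_Measure
    _ _ _ _ _ (@lebesgue_measure R \x mu) _ (@measurable_rV_cons n))).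
Qed.

HB.instance Definition _ := isMeasure.Build _ _ _ leb_cons
  leb_cons0 leb_cons_ge0 leb_cons_sigma_additive.

Let leb_cons_sigma_finite : sigma_finite setT leb_cons.
Proof.
have /sigma_finiteP[F [TF ndF Foo]] := sigma_finiteT (@lebesgue_measure R).
have /sigma_finiteP[G [TG ndG Goo]] := sigma_finiteT mu.
exists (fun k => @rV_uncons n @^-1` (F k `*` G k)).
  rewrite -preimage_bigcup (_ : \bigcup_k _ = setT) ?preimage_setT//.
  rewrite -subTset => -[x y] _.
  have [k _ Fkx] : (\bigcup_k F k) x by rewrite -TF.
  have [l _ Gly] : (\bigcup_k G k) y by rewrite -TG.
  exists (maxn k l) => //; split => /=.
    by move: x Fkx; exact/subsetPset/ndF/leq_maxl.
  by move: y Gly; exact/subsetPset/ndG/leq_maxr.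
move=> k; have [mF Fk] := Foo k; have [mG Gk] := Goo k; split.
  rewrite -[X in measurable X]setTI; apply: measurable_rV_uncons => //.
  exact: measurableX.
rewrite /leb_cons /pushforward -comp_preimage.
rewrite (_ : _ \o _ = id) ?preimage_id; last first.
  by apply/funext => p; exact: rV_consK.
by rewrite product_measure1E// lte_mul_pinfty// ge0_fin_numE.
Qed.

HB.instance Definition _ := Measure_isSigmaFinite.Build _ _ _ leb_cons
  leb_cons_sigma_finite.

End lebesgue_cons.

(* Lebesgue measure on R^n, as the iterated product of the Lebesgue measure
   on R; R^0 is a point of mass 1. *)
Fixpoint lebn n : {sigma_finite_measure set 'rV[R]_n -> \bar R} :=
  match n with
  | 0%N => \d_(0%R : 'rV[R]_0)
  | n'.+1 => leb_cons (lebn n')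
  end.

Lemma lebn_box n (a b : 'rV[R]_n) : (forall i, a 0%R i <= b 0%R i)%R ->
  lebn n [set x : 'rV[R]_n | forall i, x 0%R i \in `[a 0%R i, b 0%R i]%R] =
  (\prod_(i < n) (b 0%R i - a 0%R i))%:E.
Proof.
elim: n => [|n IH] in a b *.
  move=> _; rewrite /= big_ord0 diracE mem_set//=.
  by case.
move=> ab.
rewrite /= /leb_cons /pushforward.
pose a' : 'rV[R]_n := @rsubmx _ 1 1 n a; pose b' : 'rV[R]_n := @rsubmx _ 1 1 n b.
have abE i : (a' 0%R i <= b' 0%R i)%R by rewrite !mxE; exact: ab.
set A := (X in product_measure1 _ _ X).
have -> : A = `[a 0%R ord0, b 0%R ord0]%classic `*`
    [set x : 'rV[R]_n | forall i, x 0%R i \in `[a' 0%R i, b' 0%R i]%R].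
  have E0 (p : R * 'rV[R]_n) : rV_cons p 0%R ord0 = p.1.
    by have /(congr1 fst) := rV_consK p.
  have ES (p : R * 'rV[R]_n) (j : 'I_n) : rV_cons p 0%R (rshift 1 j) = p.2 0%R j.
    by rewrite /rV_cons row_mxEr.
  rewrite /A; apply/seteqP; split => -[t x] /=.
    move=> H; split; first by have := H ord0; rewrite E0.
    by move=> i; have := H (rshift 1 i); rewrite ES !mxE.
  move=> [Ht Hx] i; case: (@split_ordP 1 n i) => j ->.
    by rewrite ord1 (_ : lshift n 0%R = ord0) ?E0//; exact/val_inj.
  by rewrite ES; have := Hx j; rewrite !mxE.
rewrite product_measure1E//=; last first.
  rewrite (_ : mkset _ = \bigcap_(i in [set: 'I_n])
    ((fun x : 'rV[R]_n => x 0%R i) @^-1` `[a' 0%R i, b' 0%R i]%classic)).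
    apply: fin_bigcap_measurable => // i _; rewrite -[X in measurable X]setTI.
    exact: (measurable_coord i).
  by apply/seteqP; split => x /= H i; [move=> _|]; exact: H.
rewrite IH// big_ord_recl EFinM.
have -> : (\prod_(i < n) (b' 0 i - a' 0 i) =
    \prod_(i < n) (b 0 (lift ord0 i) - a 0 (lift ord0 i)))%R.
  apply: eq_bigr => i _; rewrite !mxE.
  by rewrite (_ : rshift 1 i = lift ord0 i)//; exact/val_inj.
congr (_ * _); rewrite lebesgue_measure_itv/= lte_fin.
by case: ltgtP (ab ord0) => // ->; rewrite subrr.
Qed.

End lebesgue.

Section calculus.
Context {R : realType} {n : nat}.
Implicit Types (Om : set 'rV[R]_n) (u : 'rV[R]_n -> R) (nu : 'rV[R]_n -> 'rV[R]_n).

Definition partial (i : 'I_n) u : 'rV[R]_n -> R :=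
  fun x => 'D_(delta_mx 0 i) u x.

Definition grad u : 'rV[R]_n -> 'rV[R]_n := fun x => \row_i partial i u x.

Definition laplacian u : 'rV[R]_n -> R :=
  fun x => \sum_(i < n) partial i (partial i u) x.

(* u is in C^k(Om); Om is meant to be open. *)
Fixpoint Ck (k : nat) Om u : Prop :=
  (forall x, Om x -> {for x, continuous u}) /\
  match k with
  | 0%N => True
  | k'.+1 => forall i : 'I_n,
      (forall x, Om x -> derivable u x (delta_mx 0 i)) /\ Ck k' Om (partial i u)
  end.

(* u is in C^1(closure of Om), for Om open: u is in C^1(Om), and u and its
   gradient extend continuously to the closure; u itself denotes its
   extension, and Du is the extension of the gradient.  The values of u
   outside the closure of Om play no role. *)
Definition C1_closure Om u (Du : 'rV[R]_n -> 'rV[R]_n) : Prop :=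
  [/\ Ck 1 Om u,
      {within closure Om, continuous u},
      {within closure Om, continuous Du} &
      forall x, Om x -> Du x = grad u x].

Definition boundary Om : set 'rV[R]_n := closure Om `\` interior Om.

(* v is the outward unit normal to Om at the boundary point x: to first order
   at x, Om is the half-space {h | h . v < 0}.  This determines v.  For a
   domain with C^1 boundary, locally {phi < 0} with grad phi != 0, it is the
   usual normal grad phi / |grad phi|. *)
Definition outward_unit_normal_at Om (x v : 'rV[R]_n) : Prop :=
  enorm v = 1 /\
  forall e : R, 0 < e -> \forall h \near (0 : 'rV[R]_n), h != 0 ->
    (dotv h v <= - (e * enorm h) -> Om (x + h)) /\
    (e * enorm h <= dotv h v -> ~ Om (x + h)).

Definition outward_unit_normal Om nu : Prop :=
  forall x, boundary Om x -> outward_unit_normal_at Om x (nu x).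

Definition normal_derivative (Du nu : 'rV[R]_n -> 'rV[R]_n) : 'rV[R]_n -> R :=
  fun x => dotv (Du x) (nu x).

(* Lnorm integrates over the whole space, hence the extension of u by 0. *)
Definition Lp_norm (p : R) Om u : \bar R :=
  Lnorm (lebn n) p%:E ((EFin \o u) \_ Om).

End calculus.

(* Main.v *)
(* For |p| < alpha the minimum over the closure of Om of u(y) - p.y is not
   attained on the boundary, so p is the gradient of u at a point of the lower
   contact set, where D^2 u >= 0.  Hence the ball of radius alpha is covered by
   the gradient image of the contact set, whose measure is at most the integral
   over it of det D^2 u <= (Lap u / n)^n.  If the resulting inequality is an
   equality, then by continuity every point where Lap u <> 0 is a contact point
   at which det D^2 u = (Lap u / n)^n, so D^2 u is a multiple of the identity
   there.  For n >= 2 this multiple is locally constant, hence constant on the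
   connected set Om, and u is a quadratic polynomial with gradient
   lam (x - x0).  Finally Om contains the ball of radius alpha / lam around x0
   and has the same measure. *)

Require Import Defs.
From HB Require Import structures.
From mathcomp Require Import all_boot all_order all_algebra.
From mathcomp Require Import all_classical all_reals all_analysis.
From mathcomp Require Import measurable_realfun lra ring.

Set Implicit Arguments.
Unset Strict Implicit.
Unset Printing Implicit Defensive.

Import Order.TTheory GRing.Theory Num.Theory.
Import numFieldNormedType.Exports.

Local Open Scope classical_set_scope.
Local Open Scope ring_scope.

(** * Positive definite matrices *)

(** The gradient is only of class C^1 and need not be injective, and the contact set is merely
    closed, so the area estimate is not taken from a change of variables formula. At a contact point
    the derivative is positive semidefinite; a Schur factorization and Fubini give the measure of
    linear images for positive definite matrices, strict differentiability carries this to small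
    cubes with arbitrarily small loss, and repeated halving of one large cube adds the local bounds
    up. Images are measured by outer measure. The same factorization yields the determinant bound
    and its equality case. The estimate is proved for every nonnegative measurable function that
    dominates the determinant on the contact set in a lower semicontinuous way. This freedom turns
    an equality of integrals into pointwise information. In dimension one every Hessian is scalar,
    and every convex function on an interval with end slopes [- alpha] and [alpha] gives equality,
    hence [2 <= n]. Adding a constant to [u] preserves the hypotheses, hence [c1] in the
    conclusion. *)

Section posdef.
Context {R : realFieldType}.

Definition qform n (A : 'M[R]_n) (x : 'rV[R]_n) : R := (x *m A *m x^T) 0 0.

Definition possemidef n (A : 'M[R]_n) := A^T = A /\ forall x, 0 <= qform A x.

Definition posdef n (A : 'M[R]_n) := A^T = A /\ forall x, x != 0 -> 0 < qform A x.

Lemma mulmx_tr00C n (x y : 'rV[R]_n) : (x *m y^T) 0 0 = (y *m x^T) 0 0.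
Proof. by rewrite -[x in LHS]trmxK -trmx_mul mxE. Qed.

Lemma mx_lin00 : (forall X Y : 'M[R]_1, (X + Y) 0 0 = X 0 0 + Y 0 0) *
  (forall X : 'M[R]_1, (- X) 0 0 = - X 0 0) *
  (forall c (X : 'M[R]_1), (c *: X) 0 0 = c * X 0 0) *
  (forall c : R, (c%:M : 'M[R]_1) 0 0 = c).
Proof. by split; [split; [split|]|] => *; rewrite !mxE// eqxx mulr1n. Qed.

Lemma qform_block n (a : R) (b : 'rV[R]_n) (C : 'M[R]_n) (t : R) y :
  qform (block_mx a%:M b b^T C) (row_mx t%:M y : 'rV_(1 + n)) =
  a * t ^+ 2 + t * (b *m y^T) 0 0 *+ 2 + qform C y.
Proof.
rewrite /qform mul_row_block tr_row_mx mul_row_col !mulmxDl tr_scalar_mx.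
rewrite -scalar_mxM !mul_mx_scalar !mul_scalar_mx -!scalemxAl !mx_lin00.
by rewrite (mulmx_tr00C y b); ring.
Qed.

Lemma trmx_qform n (A : 'M[R]_n) (x y : 'rV_n) : A^T = A ->
  (x *m A *m y^T) 0 0 = (y *m A *m x^T) 0 0.
Proof. by move=> sA; rewrite mulmx_tr00C trmx_mul sA mulmxA. Qed.

Lemma qformD n (A : 'M[R]_n) (x y : 'rV_n) (s : R) : A^T = A ->
  qform A (x + s *: y) = qform A x + s * (x *m A *m y^T) 0 0 *+ 2 + s ^+ 2 * qform A y.
Proof.
move=> sA; rewrite /qform linearD /= linearZ /= !mulmxDl !mulmxDr.
rewrite -!scalemxAl -!scalemxAr.
by rewrite !mx_lin00 (trmx_qform y x sA); ring.
Qed.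

(** Completing the square: the Schur complement [S] is the form of [A] minimised over the first
    coordinate, so it is again positive definite. It drives the inductions for the determinant,
    Hadamard's inequality and the scaling of measure. *)
Lemma posdef_schur n (A : 'M[R]_(1 + n)) : posdef A ->
  exists a (b : 'rV_n) (S : 'M[R]_n), [/\ 0 < a, posdef S &
    A = block_mx a%:M b b^T (S + a^-1 *: (b^T *m b))].
Proof.
move=> [sA pA]; pose a := A 0 0; pose b := ursubmx A; pose C := drsubmx A.
have AE : A = block_mx a%:M b b^T C.
  rewrite -[LHS]submxK; congr block_mx.
    by rewrite [LHS]mx11_scalar !mxE; congr ((A _ _)%:M); exact/val_inj.
  by rewrite /b trmx_ursub sA.
have sC : C^T = C by rewrite /C trmx_drsub sA.
have a0 : 0 < a.
  have := pA (row_mx 1%:M 0); rewrite AE qform_block /qform trmx0 !mulmx0 mxE.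
  rewrite mulr0 mul0rn !addr0 expr1n mulr1; apply.
  apply/eqP => /(congr1 (fun z => lsubmx z 0 0)); rewrite row_mxKl !mxE eqxx.
  by move/eqP; rewrite oner_eq0.
exists a, b, (C - a^-1 *: (b^T *m b)); split => //; last by rewrite subrK.
split; first by rewrite linearB /= linearZ /= trmx_mul trmxK sC.
move=> y y0; pose be := (b *m y^T) 0 0.
(* The value [- (be / a)] minimises the form over the first coordinate for fixed [y]. *)
have := pA (row_mx (- (be / a))%:M y); rewrite AE qform_block -/be => /(_ _).
have -> : a * (- (be / a)) ^+ 2 + - (be / a) * be *+ 2 + qform C y =
          qform C y - a^-1 * be ^+ 2.
  by field; rewrite gt_eqF.
rewrite [in X in _ -> X]/qform mulmxBr mulmxBl -scalemxAr -scalemxAl mulmxA -(mulmxA (y *m b^T)).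
rewrite !mx_lin00 -/(qform C y) [b *m y^T]mx11_scalar -/be mul_mx_scalar. rewrite !mx_lin00.
rewrite mulmx_tr00C -/be -expr2.
apply; apply: contra_neq y0 => /(congr1 rsubmx); rewrite row_mxKr => ->.
by rewrite linear0.
Qed.

Lemma schur_factor n (a : R) (b : 'rV[R]_n) (S : 'M[R]_n) : a != 0 ->
  block_mx a%:M b b^T (S + a^-1 *: (b^T *m b)) =
  block_mx 1%:M 0 (a^-1 *: b^T) 1%:M *m block_mx a%:M 0 0 1%:M *m block_mx 1%:M 0 0 S *m
  block_mx 1%:M (a^-1 *: b) 0 1%:M.
Proof.
move=> a0; rewrite !mulmx_block !(mul0mx, mulmx0, mul1mx, mulmx1, addr0, add0r).
have E : a^-1 *: b^T *m a%:M = b^T by rewrite mul_mx_scalar scalerA divff// scale1r.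
rewrite E mul_scalar_mx scalerA divff// scale1r -scalemxAr; congr block_mx.
by rewrite addrC.
Qed.

Lemma det_schur n (a : R) (b : 'rV[R]_n) (S : 'M[R]_n) : a != 0 ->
  \det (block_mx a%:M b b^T (S + a^-1 *: (b^T *m b))) = a * \det S.
Proof.
move=> a0; rewrite schur_factor// !det_mulmx !(det_ublock, det_lblock).
by rewrite !det1 !det_scalar1 !mul1r !mulr1.
Qed.

Lemma posdef_det_gt0 n (A : 'M[R]_n) : posdef A -> 0 < \det A.
Proof.
elim: n A => [|n IH] A; first by rewrite det_mx00.
by move=> /posdef_schur[a [b [S [a0 pS ->]]]]; rewrite det_schur ?gt_eqF// mulr_gt0 ?IH.
Qed.

Lemma posdef_diag_gt0 n (A : 'M[R]_n) i : posdef A -> 0 < A i i.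
Proof.
move=> [_ pA]; have := pA (delta_mx 0 i); rewrite /qform -rowE trmx_delta -colE !mxE.
by apply; apply/eqP => /matrixP /(_ 0 i); rewrite !mxE !eqxx => /eqP; rewrite oner_eq0.
Qed.

(** Passing from [A] to the Schur complement divides the determinant by [a] and lowers each
    remaining diagonal entry by [a^-1 * b 0 i ^+ 2]. Equality therefore forces [b = 0] and equality
    for [S]. *)
Lemma hadamard n (A : 'M[R]_n) : posdef A -> \det A <= \prod_i A i i /\
  (\prod_i A i i <= \det A -> is_diag_mx A).
Proof.
elim: n A => [|n IH] A pA.
  by rewrite det_mx00 big_ord0; split=> // _; apply/is_diag_mxP => -[].
have [a [b [S [a0 pS AE]]]] := posdef_schur pA.
have A00 : A ord0 ord0 = a.
  have := congr1 (fun M : 'M[R]_(1 + n) => M (lshift n ord0) (lshift n ord0)) AE.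
  by rewrite block_mxEul mxE eqxx mulr1n => <-; congr (A _ _); exact/val_inj.
have ASS i : A (lift ord0 i) (lift ord0 i) = S i i + a^-1 * b 0 i ^+ 2.
  have := congr1 (fun M : 'M[R]_(1 + n) => M (rshift 1 i) (rshift 1 i)) AE.
  rewrite block_mxEdr [in X in _ = X -> _]mxE [X in _ = _ + X -> _]mxE mxE big_ord1 mxE -expr2 => <-.
  by congr (A _ _); exact/val_inj.
rewrite big_ord_recl A00 [in \det A]AE det_schur ?gt_eqF//.
under eq_bigr do rewrite ASS.
have S0 i : 0 < S i i by apply/posdef_diag_gt0.
have b0 i : 0 <= a^-1 * b 0 i ^+ 2 by rewrite mulr_ge0 ?sqr_ge0 ?invr_ge0 ?ltW.
have leb (P : pred 'I_n) : \prod_(i | P i) S i i <= \prod_(i | P i) (S i i + a^-1 * b 0 i ^+ 2).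
  by apply: ler_prod => i _; rewrite (ltW (S0 i)) lerDl b0.
have [le1 eq1] := IH _ pS.
rewrite !ler_pM2l//; split; first by rewrite (le_trans le1)// leb.
move=> E.
have bz : b = 0.
  apply/rowP => k; rewrite mxE; apply/eqP; apply: contraT => bk.
  suff : \prod_i S i i < \prod_i (S i i + a^-1 * b 0 i ^+ 2).
    by rewrite ltNge (le_trans E).
  rewrite (bigD1 k)// [X in _ < X](bigD1 k)//=.
  apply: (@lt_le_trans _ _ ((S k k + a^-1 * b 0 k ^+ 2) * \prod_(i < n | i != k) S i i)).
    rewrite ltr_pM2r ?prodr_gt0//.
    by rewrite ltrDl mulr_gt0 ?invr_gt0// exprn_even_gt0.
  by rewrite ler_wpM2l// ?leb// addr_ge0// ltW.
have dS : is_diag_mx S by apply: eq1; rewrite (le_trans (leb _)).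
rewrite AE bz trmx0 mul0mx scaler0 addr0.
by rewrite (@is_diag_block_mx _ 1 n 1 n)// !eqxx/= scalar_mx_is_diag.
Qed.

(** Hadamard followed by the arithmetic-geometric mean inequality on the diagonal. In case of
    equality the first makes [A] diagonal and the second makes its diagonal entries equal. *)
Lemma det_le_AGM n (A : 'M[R]_n) : posdef A -> \det A <= (\tr A / n%:R) ^+ n /\
  ((\tr A / n%:R) ^+ n <= \det A -> A = (\tr A / n%:R)%:M).
Proof.
move=> pA; have [le1 eq1] := hadamard pA.
have A0 i : 0 < A i i by apply/posdef_diag_gt0.
have := @leif_AGM R 'I_n predT (fun i => A i i) (fun i _ => ltW (A0 i)).
rewrite /= cardT size_enum_ord -/(\tr A) => -[le2 eq2].
split; first exact: le_trans le2.
move=> E; have /is_diag_mxP dA : is_diag_mx A by rewrite eq1// (le_trans le2).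
have : \prod_i A i i == (\tr A / n%:R) ^+ n by rewrite eq_le le2 (le_trans E).
rewrite eq2 => /forall_inP ad.
apply/matrixP => i j; rewrite !mxE; case: eqVneq => [<-|ij]; last first.
  by rewrite mulr0n dA.
have nz : (n%:R : R) != 0 by rewrite pnatr_eq0; case: (n) i {j} => // -[].
rewrite mulr1n; apply: (mulIf nz); rewrite divfK// /mxtrace.
have -> : \sum_k A k k = \sum_(k < n) A i i.
  by apply: eq_bigr => k _; apply/eqP; have /forall_inP := ad k isT; apply.
by rewrite sumr_const card_ord mulr_natr.
Qed.

(** A zero of a semidefinite form is a minimum of it, hence lies in the kernel of [A]. *)
Lemma possemidef_posdef n (A : 'M[R]_n) : possemidef A -> \det A != 0 -> posdef A.
Proof.
move=> [sA pA] dA; split => // x x0; rewrite lt_neqAle pA andbT.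
apply: contraNneq x0 => /esym q0.
have uA : A \in unitmx by rewrite unitmxE unitfE.
suff E : x *m A = 0 by rewrite -[x](mulmxK uA) E mul0mx.
have key (y : 'rV_n) : (x *m A *m y^T) 0 0 = 0.
  set b := (x *m A *m y^T) 0 0; apply/eqP; apply: contraT => b0.
  pose c := qform A y.
  have c0 : 0 < c + 1 by rewrite ltr_wpDl// pA.
  (* With [b != 0] this perturbation gives the value [- b ^+ 2 * (c + 2) / (c + 1) ^+ 2], which is
     negative. The shift by 1 keeps the denominator nonzero when [c = 0]. *)
  have := pA (x + (- (b / (c + 1))) *: y).
  rewrite qformD// q0 -/b -/c => h.
  have : 0 < b ^+ 2 by rewrite exprn_even_gt0.
  suff -> : b ^+ 2 = - (0 + - (b / (c + 1)) * b *+ 2 + (- (b / (c + 1))) ^+ 2 * c) *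
     ((c + 1) ^+ 2 / (c + 2)).
    rewrite mulNr oppr_gt0 ltNge mulr_ge0// divr_ge0// ?sqr_ge0//.
    by rewrite addr_ge0// pA.
  have c2 : c + 2 != 0 by apply: lt0r_neq0; lra.
  by field; rewrite c2 lt0r_neq0.
apply/rowP => k; have := key (delta_mx 0 k).
by rewrite trmx_delta -colE !mxE.
Qed.

Lemma possemidefD_scalar n (A : 'M[R]_n) t : possemidef A -> 0 < t -> posdef (A + t%:M).
Proof.
move=> [sA pA] t0; split; first by rewrite linearD /= tr_scalar_mx sA.
move=> x x0; rewrite /qform mulmxDr mulmxDl mx_lin00 ltr_wpDl ?pA//.
rewrite mul_mx_scalar -scalemxAl mx_lin00 mulr_gt0// mxE.
have [i xi] : exists i, x 0 i != 0.
  by apply/existsP; apply: contraNT x0 => /existsPn h; apply/eqP/rowP => i;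
    rewrite mxE; apply/eqP/negbNE/h.
rewrite (bigD1 i)//= ltr_wpDr//; first by apply: sumr_ge0 => j _; rewrite mxE -expr2 sqr_ge0.
by rewrite mxE -expr2 exprn_even_gt0.
Qed.

End posdef.

(** * Lebesgue measure under linear maps *)

Section scaling.
Context {R : realType}.
Local Notation leb := (@lebesgue_measure R).

(** Stated through preimages, so that it composes without inverses or measurability of images; for
    an invertible [f] it expresses that [f] multiplies measure by [c]. *)
Definition scales_measure d (T : measurableType d) (mu : set T -> \bar R) (f : T -> T) (c : R) :=
  measurable_fun setT f /\
  forall E, measurable E -> (c%:E * mu (f @^-1` E) = mu E)%E.

Lemma scales_comp d (T : measurableType d) (mu : set T -> \bar R) (f g : T -> T) b c :
  scales_measure mu f b -> scales_measure mu g c -> scales_measure mu (f \o g) (b * c).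
Proof.
move=> [mf fE] [mg gE]; split; first exact: measurableT_comp.
move=> E mE; rewrite comp_preimage EFinM -muleA gE ?fE//.
by rewrite -[X in measurable X]setTI; exact: mf.
Qed.

Lemma scales_id d (T : measurableType d) (mu : set T -> \bar R) : scales_measure mu id 1.
Proof. by split => // E _; rewrite mul1e. Qed.

(** The rescaled pushforward agrees with Lebesgue measure on intervals, and uniqueness of Lebesgue
    measure does the rest. *)
Lemma scales_affine (a c : R) : 0 < a -> scales_measure leb (fun t => a * t + c) a.
Proof.
move=> a0; have mf : measurable_fun [set: R] (fun t => a * t + c).
  by apply: measurable_funD => //; apply: measurable_funM.
split => // E mE.
pose pf := @measure_function_pushforward__canonical__measure_function_Measure
    _ _ (measurableTypeR R) (measurableTypeR R) _ leb (fun t : R => a * t + c) mf.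
pose nu' : {measure set (measurableTypeR R) -> \bar R} :=
  [the measure _ _ of mscale (NngNum (ltW a0)) pf].
apply/esym; refine (@lebesgue_measure_unique R nu' _ E mE) => X [[p q] /= pq <-].
rewrite /nu' /mscale /= /pushforward.
rewrite (_ : _ @^-1` _ = `](p - c) / a, (q - c) / a]%classic); last first.
  apply/seteqP; split => t /=; rewrite !in_itv/= ltr_pdivrMr// ler_pdivlMr// mulrC;
  by rewrite ltrBlDr lerBrDr.
rewrite !lebesgue_measure_itv/= !lte_fin ltr_pM2r ?invr_gt0// ltrD2r.
case: ifP => _; last by rewrite mule0.
by rewrite -!EFinB -EFinM; congr EFin; field; rewrite gt_eqF.
Qed.

Lemma lebnSE n (E : set 'rV[R]_(1 + n)) : lebn n.+1 E = (leb \x lebn n)%E (@rV_cons R n @^-1` E).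
Proof. by []. Qed.

Lemma rV_unconsK n : cancel (@rV_uncons R n) (@rV_cons R n).
Proof.
move=> x; rewrite /rV_cons /rV_uncons /= -[RHS]hsubmxK; congr row_mx.
by apply/rowP => i; rewrite !mxE ord1 eqxx mulr1n; congr (x _ _); exact/val_inj.
Qed.

Lemma measurable_preimage d d' (T : measurableType d) (T' : measurableType d') (f : T -> T') E :
  measurable_fun setT f -> measurable E -> measurable (f @^-1` E).
Proof. by move=> mf mE; rewrite -[X in measurable X]setTI; exact: mf. Qed.

(** [lebn] is built by integrating over the first coordinate, whereas a map that changes only the
    first coordinate has to be studied on sections with the other coordinates fixed. *)
Lemma product_measure_swap n (E : set (R * 'rV[R]_n)) : measurable E ->
  (leb \x lebn n)%E E = (leb \x^ lebn n)%E E.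
Proof.
by move=> mE; apply: product_measure_unique => // A B mA mB; rewrite /= product_measure2E.
Qed.

(** Cavalieri's principle: every line on which the last coordinates are fixed is mapped to itself
    with lengths scaled by the same factor. *)
Lemma scales_skew_fst n (f : R -> 'rV[R]_n -> R) (c : R) : 0 <= c ->
  measurable_fun setT (fun p : R * 'rV[R]_n => f p.1 p.2) ->
  (forall y, scales_measure leb (f^~ y) c) ->
  scales_measure (lebn n.+1)
    (fun x => let p := rV_uncons x in rV_cons (f p.1 p.2, p.2)) c.
Proof.
move=> c0 mf sf; pose g (p : R * 'rV[R]_n) := (f p.1 p.2, p.2).
have mg : measurable_fun setT g by apply/measurable_fun_pairP; split => //; exact: measurable_snd.
rewrite (_ : (fun _ => _) = @rV_cons R n \o g \o @rV_uncons R n)//.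
split; first by apply: measurableT_comp; [apply: measurableT_comp => //; exact: measurable_rV_cons|exact: measurable_rV_uncons].
move=> E mE; rewrite !lebnSE; set E' := @rV_cons R n @^-1` E.
have -> : @rV_cons R n @^-1` ((@rV_cons R n \o g \o @rV_uncons R n) @^-1` E) = g @^-1` E'.
  by apply/funext => p; rewrite /= /preimage /mkset rV_consK.
have mE' : measurable E' by exact: (measurable_preimage (@measurable_rV_cons R n)).
have mgE : measurable (g @^-1` E') by exact: measurable_preimage.
rewrite !product_measure_swap// /product_measure2 -ge0_integralZl//=; last first.
  by apply: measurable_fun_ysection.
apply: eq_integral => y _ /=; have [_ /(_ (ysection E' y)) <-] := sf y; last exact: measurable_ysection.
by congr (_ * leb _)%E; apply/seteqP; split => t; rewrite /ysection/= !inE.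
Qed.

Lemma scales_skew_snd n (f : R -> 'rV[R]_n -> 'rV[R]_n) (c : R) : 0 <= c ->
  measurable_fun setT (fun p : R * 'rV[R]_n => f p.1 p.2) ->
  (forall t, scales_measure (lebn n) (f t) c) ->
  scales_measure (lebn n.+1)
    (fun x => let p := rV_uncons x in rV_cons (p.1, f p.1 p.2)) c.
Proof.
move=> c0 mf sf; pose g (p : R * 'rV[R]_n) := (p.1, f p.1 p.2).
have mg : measurable_fun setT g by apply/measurable_fun_pairP; split => //; exact: measurable_fst.
rewrite (_ : (fun _ => _) = @rV_cons R n \o g \o @rV_uncons R n)//.
split; first by apply: measurableT_comp; [apply: measurableT_comp => //; exact: measurable_rV_cons|exact: measurable_rV_uncons].
move=> E mE; rewrite !lebnSE; set E' := @rV_cons R n @^-1` E.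
have -> : @rV_cons R n @^-1` ((@rV_cons R n \o g \o @rV_uncons R n) @^-1` E) = g @^-1` E'.
  by apply/funext => p; rewrite /= /preimage /mkset rV_consK.
have mE' : measurable E' by exact: (measurable_preimage (@measurable_rV_cons R n)).
have mgE : measurable (g @^-1` E') by exact: measurable_preimage.
rewrite /product_measure1 -ge0_integralZl//=; last first.
  by apply: measurable_fun_xsection.
apply: eq_integral => y _ /=; have [_ /(_ (xsection E' y)) <-] := sf y; last exact: measurable_xsection.
by congr (_ * lebn n _)%E; apply/seteqP; split => t; rewrite /xsection/= !inE.
Qed.

Lemma measurable_mulmx n m (A : 'M[R]_(n, m)) : measurable_fun setT (fun x : 'rV[R]_n => x *m A).
Proof.
apply/measurable_fun_rVP => j; under eq_fun do rewrite mxE.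
by apply: measurable_sum => i; apply: measurable_funM => //; exact: measurable_coord.
Qed.

Lemma measurable_rVD d (T : measurableType d) n (f g : T -> 'rV[R]_n) :
  measurable_fun setT f -> measurable_fun setT g -> measurable_fun setT (fun x => f x + g x).
Proof.
move=> mf mg; apply/measurable_fun_rVP => j; under eq_fun do rewrite mxE.
by apply: measurable_funD; exact: (measurableT_comp (measurable_coord j)).
Qed.

Lemma measurable_rVZ d (T : measurableType d) n (f : T -> R) (v : 'rV[R]_n) :
  measurable_fun setT f -> measurable_fun setT (fun x => f x *: v).
Proof.
move=> mf; apply/measurable_fun_rVP => j; under eq_fun do rewrite mxE.
by apply: measurable_funM.
Qed.

Lemma scales_translation n (v : 'rV[R]_n) : scales_measure (lebn n) (fun x => x + v) 1.
Proof.
elim: n v => [|n IH] v.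
  rewrite (_ : (fun _ => _) = id); first exact: scales_id.
  by apply/funext => x; apply/rowP => -[].
have h1 := @scales_skew_fst n (fun t _ => 1 * t + (rV_uncons v).1) 1 ler01 _ (fun=> scales_affine _ ltr01).
have h2 := @scales_skew_snd n (fun _ x => x + (rV_uncons v).2) 1 ler01 _ (fun=> IH _).
have m1 : measurable_fun setT (fun p : R * 'rV[R]_n => 1 * p.1 + (rV_uncons v).1).
  by apply: measurable_funD => //; apply: measurable_funM => //; exact: measurable_fst.
have m2 : measurable_fun setT (fun p : R * 'rV[R]_n => p.2 + (rV_uncons v).2).
  by apply: measurable_rVD => //; exact: measurable_snd.
have := scales_comp (h1 m1) (h2 m2); rewrite mulr1; congr scales_measure.
apply/funext => x; rewrite /comp; cbv zeta beta; rewrite !rV_consK mul1r /fst /snd.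
by rewrite -[x + v]rV_unconsK; congr rV_cons; rewrite /rV_uncons /= !mxE linearD.
Qed.

(** The redundant [1 *] and [+ 0] keep the right-hand side in the shape produced by composing
    instances of [scales_affine]. *)
Lemma mul_row_schur n (a t : R) (b y : 'rV[R]_n) (S : 'M[R]_n) :
  row_mx t%:M y *m (block_mx 1%:M 0 (a^-1 *: b^T) 1%:M *m block_mx a%:M 0 0 1%:M *m
    block_mx 1%:M 0 0 S *m block_mx 1%:M (a^-1 *: b) 0 1%:M) =
  row_mx (a * (1 * t + (y *m (a^-1 *: b^T)) 0 0) + 0)%:M
    (y *m S + (a * (1 * t + (y *m (a^-1 *: b^T)) 0 0) + 0) *: (a^-1 *: b)).
Proof.
rewrite !mulmxA !mul_row_block !(mul0mx, mulmx0, mul1mx, mulmx1, addr0, add0r) mul1r.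
rewrite [in LHS](mx11_scalar (y *m _)) -raddfD /= -scalar_mxM mul_scalar_mx [_ * a]mulrC.
by congr row_mx; exact: addrC.
Qed.

(* With the Schur factorization A = L D U, each factor moves the first
   coordinate or the remaining ones only, so Fubini and induction apply. *)
Lemma scales_posdef n (A : 'M[R]_n) : posdef A -> scales_measure (lebn n) (mulmx^~ A) (\det A).
Proof.
elim: n A => [|n IH] A pA.
  rewrite (_ : mulmx^~ A = id) ?det_mx00; first exact: scales_id.
  by apply/funext => x; apply/rowP => -[].
have [a [b [S [a0 pS ->]]]] := posdef_schur pA.
rewrite det_schur ?gt_eqF// schur_factor ?gt_eqF//.
have mc (v : 'cV[R]_n) : measurable_fun setT (fun p : R * 'rV[R]_n => (p.2 *m v) 0 0).
  apply: (measurableT_comp (measurable_coord 0)).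
  by apply: (measurableT_comp (measurable_mulmx v)); exact: measurable_snd.
have h1 := @scales_skew_fst n (fun t y => 1 * t + (y *m (a^-1 *: b^T)) 0 0) 1 ler01
  _ (fun y => scales_affine _ ltr01).
have {h1} /h1 : measurable_fun setT (fun p : R * 'rV[R]_n => 1 * p.1 + (p.2 *m (a^-1 *: b^T)) 0 0).
  by apply: measurable_funD => //; apply: measurable_funM => //; exact: measurable_fst.
have h2 := @scales_skew_fst n (fun t y => a * t + 0) a (ltW a0) _ (fun y => scales_affine _ a0).
have {h2} /h2 : measurable_fun setT (fun p : R * 'rV[R]_n => a * p.1 + 0).
  by apply: measurable_funD => //; apply: measurable_funM => //; exact: measurable_fst.
have h3 := @scales_skew_snd n (fun t y => y *m S) _ (ltW (posdef_det_gt0 pS)) _ (fun t => IH _ pS).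
have {h3} /h3 : measurable_fun setT (fun p : R * 'rV[R]_n => p.2 *m S).
  by apply: (measurableT_comp (measurable_mulmx S)); exact: measurable_snd.
have h4 := @scales_skew_snd n (fun t y => y + t *: (a^-1 *: b)) 1 ler01 _
  (fun t => scales_translation _).
have {h4} /h4 : measurable_fun setT (fun p : R * 'rV[R]_n => p.2 + p.1 *: (a^-1 *: b)).
  by apply: measurable_rVD; [exact: measurable_snd|apply: measurable_rVZ; exact: measurable_fst].
move=> h4 h3 h2 h1.
have := scales_comp h4 (scales_comp h3 (scales_comp h2 h1)).
rewrite !(mul1r, mulr1) [\det S * a]mulrC; congr scales_measure.
apply/funext => x; rewrite -[x]rV_unconsK; case: (rV_uncons x) => {x} t y.
rewrite /comp; cbv zeta beta; rewrite !rV_consK /=.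
by rewrite /rV_cons mul_row_schur.
Qed.

End scaling.

(** * Cubes *)

Section cubes.
Context {R : realType} {n : nat}.
Implicit Types (a x y : 'rV[R]_n) (h r : R).

Definition cbox x r : set 'rV[R]_n := [set y | forall i, `|y 0 i - x 0 i| <= r].

Lemma cbox_center x r : 0 <= r -> cbox x r x.
Proof. by move=> r0 i; rewrite subrr normr0. Qed.

Lemma nbhs_cboxP x (A : set 'rV[R]_n) : nbhs x A <-> exists2 r, 0 < r & cbox x r `<=` A.
Proof.
split.
  move=> /nbhs_ballP[e /= e0 eA]; exists (e / 2); first by rewrite divr_gt0.
  move=> y xy; apply: eA; split => // i j; rewrite ord1 /ball /= distrC.
  by apply: le_lt_trans (xy j) _; rewrite ltr_pdivrMr// ltr_pMr// ltr1n.
move=> [r r0 rA]; apply/nbhs_ballP; exists r => //= y xy; apply: rA => i.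
by have := xy.2 0 i; rewrite /ball/= distrC => /ltW.
Qed.

(** Half open, so that the halved cubes partition their parent exactly and integrals add up over
    them. *)
Definition qcube a h : set 'rV[R]_n := [set x | forall i, a 0 i <= x 0 i < a 0 i + h].

Lemma measurable_coord_set (J : 'I_n -> set R) : (forall i, measurable (J i)) ->
  measurable [set x : 'rV[R]_n | forall i, J i (x 0 i)].
Proof.
move=> mJ; rewrite (_ : mkset _ = \bigcap_(i in [set: 'I_n]) ((fun x : 'rV[R]_n => x 0 i) @^-1` J i)).
  apply: fin_bigcap_measurable => // i _.
  exact: (measurable_preimage (@measurable_coord R n i) (mJ i)).
by apply/seteqP; split => x /= H i; [move=> _|]; exact: H.
Qed.

Lemma qcubeE a h : qcube a h = [set x | forall i, `[a 0 i, a 0 i + h[%classic (x 0 i)].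
Proof. by apply/seteqP; split => x H i; have := H i; rewrite /= in_itv. Qed.

Lemma measurable_qcube a h : measurable (qcube a h).
Proof. by rewrite qcubeE; apply: (measurable_coord_set (fun i => measurable_itv _)). Qed.

Lemma cboxE a h : cbox a h = [set x | forall i, `[a 0 i - h, a 0 i + h]%classic (x 0 i)].
Proof. by apply/seteqP; split => x H i; have := H i; rewrite /= in_itv/= ler_distl. Qed.

Lemma measurable_cbox a h : measurable (cbox a h).
Proof. by rewrite cboxE; apply: (measurable_coord_set (fun i => measurable_itv _)). Qed.

(** The sigma-algebra is generated by the coordinates, so openness has to be converted: an open set
    is the countable union of the cubes inside it with rational centre and half-side
    [k.+1%:R^-1]. *)
Lemma open_measurable_rV (O : set 'rV[R]_n) : open O -> measurable O.
Proof.
move=> oO; pose c (p : 'rV[rat]_n * nat) := cbox (map_mx ratr p.1) (p.2.+1%:R^-1).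
rewrite (_ : O = \bigcup_(p in [set p | c p `<=` O]) c p).
  rewrite bigcup_mkcond; apply: countable_bigcupT_measurable => // p.
  by case: ifP => // _; exact: measurable_cbox.
apply/seteqP; split => [x Ox|x [p /= h /h]//].
have /nbhs_cboxP[r r0 rO] : nbhs x O by exact: open_nbhs_nbhs.
have [k _ hk] : exists2 k : nat, True & k.+1%:R^-1 < r / 2.
  have /= := near_infty_natSinv_lt (PosNum (divr_gt0 r0 (ltr0n R 2))).
  by case=> k _ /(_ k (leqnn k)) ?; exists k.
have k0 : 0 < k.+1%:R^-1 :> R by rewrite invr_gt0.
have [q hq] : exists q : 'rV[rat]_n, cbox (map_mx ratr q) k.+1%:R^-1 x.
  have h i : exists q : rat, `|x 0 i - ratr q| <= k.+1%:R^-1.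
    have [q] := @rat_in_itvoo R (x 0 i - k.+1%:R^-1) (x 0 i + k.+1%:R^-1)
       ltac:(by rewrite ltrD2l gtrN).
    by rewrite in_itv/= => /andP[q1 q2]; exists q; rewrite distrC ler_distl !ltW.
  have [f fP] := choice h.
  by exists (\row_i f i) => i; rewrite !mxE.
exists (q, k) => //= y qy; apply: rO => i.
have h1 : `|y 0 i - (map_mx ratr q : 'rV[R]_n) 0 i| <= k.+1%:R^-1 := qy i.
have h2 : `|x 0 i - (map_mx ratr q : 'rV[R]_n) 0 i| <= k.+1%:R^-1 := hq i.
have := ler_distD ((map_mx ratr q : 'rV[R]_n) 0 i) (y 0 i) (x 0 i).
by rewrite [X in _ <= _ + X]distrC; move: hk h1 h2; set z := (k.+1%:R^-1); lra.
Qed.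

Definition child a h (e : {ffun 'I_n -> bool}) : 'rV[R]_n :=
  \row_i (a 0 i + (if e i then h / 2 else 0)).

Lemma qcube_children a h : 0 < h ->
  qcube a h = \big[setU/set0]_(e <- index_enum {ffun 'I_n -> bool}) qcube (child a h e) (h / 2).
Proof.
move=> h0; rewrite -bigcup_seq; apply/seteqP; split => x /=.
  move=> ax; pose e := [ffun i => a 0 i + h / 2 <= x 0 i].
  exists e => /=; first by rewrite mem_index_enum.
  by move=> i; rewrite mxE ffunE; have := ax i; case: ifPn; lra.
by move=> [e _ ex] i; have := ex i; rewrite mxE; case: ifP; lra.
Qed.

Lemma trivIset_children a h : 0 < h ->
  trivIset [set: {ffun 'I_n -> bool}] (fun e => qcube (child a h e) (h / 2)).
Proof.
move=> h0 e e' _ _ [x [ex ex']]; apply/ffunP => i.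
by have := ex i; have := ex' i; rewrite !mxE; case: (e i); case: (e' i) => //; lra.
Qed.

(* Cousin's lemma.  It reduces a global area estimate to infinitesimal cubes,
   without a covering theorem. *)
Lemma cousin (P : 'rV[R]_n -> R -> Prop) :
  (forall a h, 0 < h -> (forall e, P (child a h e) (h / 2)) -> P a h) ->
  (forall x, exists2 r, 0 < r & forall a h, 0 < h -> h <= r -> cbox x r a -> P a h) ->
  forall a h, 0 < h -> P a h.
Proof.
move=> Pchild Ploc a0 h0 h0_gt0; apply: contrapT => nP0.
(* Failure of [P] on a cube passes to some child. The default of [odflt] is reached only when no
   child fails, which [nextP] excludes. *)
pose next a h := odflt [ffun=> false] [pick e | ~~ `[< P (child a h e) (h / 2) >]].
have nextP a h : 0 < h -> ~ P a h -> ~ P (child a h (next a h)) (h / 2).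
  move=> hgt0 nP; rewrite /next; case: pickP => [e /asboolPn//|allP] _.
  by apply: nP; apply: Pchild => // e; have /negbFE/asboolP := allP e.
pose h k := h0 / 2 ^+ k.
pose fix a k := if k is k'.+1 then child (a k') (h k') (next (a k') (h k')) else a0.
have hS k : h k.+1 = h k / 2 by rewrite /h exprSr invfM mulrA.
have h_gt0 k : 0 < h k by rewrite divr_gt0// exprn_gt0.
have nP k : ~ P (a k) (h k).
  elim: k => [|k IH]; first by rewrite /h expr0 divr1.
  by rewrite hS; exact: nextP.
have aS k i : a k 0 i <= a k.+1 0 i /\ a k.+1 0 i + h k.+1 <= a k 0 i + h k.
  have := h_gt0 k; rewrite /= mxE hS; case: ifP => _; split; lra.
have amono i k m : (k <= m)%N -> a k 0 i <= a m 0 i /\ a m 0 i + h m <= a k 0 i + h k.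
  elim: m => [|m IH]; first by rewrite leqn0 => /eqP->.
  rewrite leq_eqVlt => /predU1P[->//|]; rewrite ltnS => /IH[h1 h2].
  by have [h3 h4] := aS m i; split; [exact: le_trans h3|exact: le_trans h2].
have ale i k m : a m 0 i <= a k 0 i + h k.
  have [/amono-/(_ i)[h1 h2]|/ltnW/amono-/(_ i)[h1 h2]] := leqP k m.
    by rewrite (le_trans _ h2)// lerDl ltW.
  by rewrite (le_trans h1)// lerDl ltW.
pose S i := [set a k 0 i | k in [set: nat]].
(* The lower corners increase in each coordinate, so their suprema give a point of all the nested
   closed cubes. *)
pose x : 'rV[R]_n := \row_i sup (S i).
have ax k i : a k 0 i <= x 0 i <= a k 0 i + h k.
  rewrite mxE; apply/andP; split.
    apply: ub_le_sup; last by exists k.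
    by exists (a k 0 i + h k) => _ [m _ <-].
  apply: ge_sup; first by exists (a k 0 i), k.
  by move=> _ [m _ <-].
have [r r0 xr] := Ploc x.
have [k hk] : exists k, h k <= r.
  exists (Num.truncn (h0 / r)).+1; rewrite /h ler_pdivrMr ?exprn_gt0// mulrC -ler_pdivrMr//.
  apply: le_trans (ltW (truncnS_gt _)) _.
  by rewrite -natrX ler_nat ltnW// ltn_expl.
apply: (nP k); apply: xr => // i; have := ax k i => /andP[h1 h2].
by rewrite distrC ler_distl; apply/andP; split; lra.
Qed.

End cubes.

(** * Volumes of cubes and outer measure of affine images *)

Section boxes.
Context {R : realType}.
Local Notation leb := (@lebesgue_measure R).

Lemma lebn_coord_set n (J : 'I_n -> set R) (c : 'I_n -> R) :
  (forall i, measurable (J i)) -> (forall i, leb (J i) = (c i)%:E) ->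
  lebn n [set x : 'rV[R]_n | forall i, J i (x 0 i)] = (\prod_i c i)%:E.
Proof.
elim: n J c => [|n IH] J c mJ Jc.
  by rewrite /= big_ord0 diracE mem_set//=; case.
rewrite lebnSE.
rewrite (_ : _ @^-1` _ = J ord0 `*`
    [set x : 'rV[R]_n | forall i, J (lift ord0 i) (x 0 i)]); last first.
  have E0 (p : R * 'rV[R]_n) : rV_cons p 0 ord0 = p.1.
    by have /(congr1 fst) := rV_consK p.
  have ES (p : R * 'rV[R]_n) (j : 'I_n) : rV_cons p 0 (lift ord0 j) = p.2 0 j.
    by rewrite (_ : lift ord0 j = rshift 1 j) ?/rV_cons ?row_mxEr//; exact/val_inj.
  apply/seteqP; split => -[t x] /=.
    move=> H; split; first by have := H ord0; rewrite E0.
    by move=> i; have := H (lift ord0 i); rewrite ES.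
  move=> [Ht Hx] i; case: (unliftP ord0 i) => [j ->|->]; last by rewrite E0.
  by rewrite ES; exact: Hx.
rewrite product_measure1E /=; [|exact: mJ|exact: (measurable_coord_set (fun i => mJ _))].
by rewrite (IH (fun i => J (lift ord0 i)) (fun i => c (lift ord0 i)))// Jc big_ord_recl EFinM.
Qed.

Lemma lebn_qcube n (a : 'rV[R]_n) h : 0 <= h -> lebn n (qcube a h) = (h ^+ n)%:E.
Proof.
move=> h0; rewrite qcubeE (lebn_coord_set (J := fun i => `[a 0 i, a 0 i + h[%classic) (c := fun=> h))//.
  by rewrite prodr_const card_ord.
move=> i; rewrite lebesgue_measure_itv/= lte_fin ltrDl; case: ltP => [_|h0'].
  by rewrite -EFinD; congr EFin; ring.
by congr EFin; apply/eqP; rewrite eq_le h0.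
Qed.

Lemma lebn_cbox n (a : 'rV[R]_n) h : 0 <= h -> lebn n (cbox a h) = ((h *+ 2) ^+ n)%:E.
Proof.
move=> h0; rewrite cboxE (lebn_coord_set (J := fun i => `[a 0 i - h, a 0 i + h]%classic) (c := fun=> h *+ 2))//.
  by rewrite prodr_const card_ord.
move=> i; rewrite lebesgue_measure_itv/= lte_fin; case: ltP => [_|h0'].
  by rewrite -EFinD; congr EFin; ring.
by congr EFin; lra.
Qed.

(** Images under the gradient map are bounded in outer measure, so their measurability never has to
    be established. *)
Definition lebn_outer n := (mu_ext (@lebn R n)).

Lemma lebn_outerE n (A : set 'rV[R]_n) : measurable A -> lebn_outer A = lebn n A.
Proof. by move=> mA; rewrite /lebn_outer measurable_mu_extE. Qed.

Lemma le_lebn_outer n (A B : set 'rV[R]_n) : A `<=` B -> (lebn_outer A <= lebn_outer B)%E.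
Proof. exact: le_mu_ext. Qed.

Lemma lebn_outer_bigsetU n (I : Type) (s : seq I) (F : I -> set 'rV[R]_n) :
  (lebn_outer (\big[setU/set0]_(i <- s) F i) <= \sum_(i <- s) lebn_outer (F i))%E.
Proof.
elim: s => [|i s IH]; first by rewrite !big_nil lebn_outerE// measure0.
rewrite !big_cons; apply: le_trans (outer_measureU2 _ _ _) _.
exact: leeD2l.
Qed.

Lemma lebn_outer_affine n (A : 'M[R]_n) (v : 'rV[R]_n) (M h : R) : posdef A -> 0 < h -> 0 <= M ->
  (lebn_outer [set (v + h *: (y *m A))%R | y in cbox 0%R M] <= (\det A * (M *+ 2) ^+ n * h ^+ n)%R%:E)%E.
Proof.
move=> pA h0 M0.
have phA : posdef (h *: A).
  have [sA qA] := pA; split; first by rewrite linearZ /= sA.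
  by move=> x x0; rewrite /qform -scalemxAr -scalemxAl mx_lin00 mulr_gt0// qA.
have uA : h *: A \in unitmx by rewrite unitmxE unitfE gt_eqF// posdef_det_gt0.
have := scales_comp (scales_translation v) (scales_posdef phA).
rewrite mul1r => -[mf fE].
(* The inverse of the affine map: the image of the cube lies in its preimage under [g], which is
   measurable. *)
pose g (z : 'rV[R]_n) := (z - v) *m invmx (h *: A).
have mg : measurable_fun setT g.
  apply: (measurableT_comp (measurable_mulmx _)).
  exact: (scales_translation (- v)).1.
have mE : measurable (g @^-1` cbox 0 M) by apply: measurable_preimage => //; exact: measurable_cbox.
apply: (@le_trans _ _ (lebn n (g @^-1` cbox 0 M))).
  rewrite -lebn_outerE//; apply: le_lebn_outer => _ [y My <-].
  by rewrite /preimage /= /g addrC addKr scalemxAr mulmxK.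
rewrite -fE// (_ : _ @^-1` (g @^-1` _) = cbox 0 M); last first.
  by apply/funext => y; rewrite /preimage /mkset /= /g addrK mulmxK.
rewrite lebn_cbox// detZ -EFinM lee_fin le_eqVlt; apply/orP; left; apply/eqP; ring.
Qed.

(** As a function of [t] this is the characteristic polynomial of [- A]. *)
Lemma det_shift_continuous n (A : 'M[R]_n) : continuous (fun t : R => \det (A + t%:M)).
Proof.
rewrite (_ : (fun _ => _) = horner (char_poly (- A))); first exact: continuous_horner.
apply/funext => t; rewrite /char_poly -horner_evalE -det_map_mx; congr (\det _).
apply/matrixP => i j; rewrite !mxE /= /horner_eval !hornerE.
by rewrite hornerMn hornerX addrC opprK.
Qed.

End boxes.

(** * Measure of the image of a map with positive semidefinite derivative *)

Section images.
Context {R : realType}.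

Lemma continuous_ltr_right (f : R -> R) x c : {for x, continuous f} -> f x < c ->
  exists2 d, 0 < d & f (x + d) < c.
Proof.
move=> cf fc; have : \forall y \near x, f y < c by exact: cvgr_lt cf c fc.
move=> /nbhs_ballP[e /= e0 he].
exists (e / 2); first by rewrite divr_gt0.
by apply: he; rewrite /ball/= opprD addNKr normrN gtr0_norm ?divr_gt0// gtr_pMr// invf_lt1// ltr1n.
Qed.

Lemma mulmx_cbox0 n m (M : 'M[R]_(n, m)) r w : cbox 0 r w ->
  cbox 0 ((\sum_i \sum_j `|M i j|) * r) (w *m M).
Proof.
move=> hw j; rewrite !mxE subr0 mulr_suml; apply: le_trans (ler_norm_sum _ _ _) _.
apply: ler_sum => i _; have := hw i; rewrite mxE subr0 normrM mulrC => wr.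
apply: ler_pM => //; rewrite (bigD1 j)//= lerDl; exact: sumr_ge0.
Qed.

(** The bound is uniform in [t]. Pairing the equation with [y] and dropping the form of [A] gives
    $|y|^2 \le z\cdot y \le 2n + |y|^2/2$, hence $|y|^2 \le 4n \le (2n)^2$. *)
Lemma shifted_inverse_bound n (A : 'M[R]_n) t (y z : 'rV[R]_n) : possemidef A -> 0 < t ->
  cbox 0 2 z -> y *m (A + t%:M) = t *: z -> cbox 0 (n%:R *+ 2) y.
Proof.
move=> [_ pA] t0 hz yE i; rewrite mxE subr0.
have n1 : 1 <= n%:R :> R by rewrite ler1n (leq_trans _ (ltn_ord i)).
have : t * \sum_j y 0 j ^+ 2 <= t * \sum_j z 0 j * y 0 j.
  have -> : t * (\sum_j z 0 j * y 0 j) = qform (A + t%:M) y.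
    rewrite /qform yE -scalemxAl mx_lin00 mxE; congr (_ * _).
    by apply: eq_bigr => j _; rewrite mxE.
  rewrite /qform mulmxDr mulmxDl mx_lin00 mul_mx_scalar -scalemxAl mx_lin00 -/(qform A y).
  rewrite mxE; under [in leRHS]eq_bigr do rewrite mxE -expr2.
  by rewrite lerDr.
rewrite ler_pM2l// => h.
have h2 : \sum_j z 0 j * y 0 j <= \sum_j (2 + y 0 j ^+ 2 / 2).
  apply: ler_sum => j _; have := hz j; rewrite mxE subr0.
  have := sqr_ge0 (z 0 j - y 0 j).
  rewrite ler_norml => q /andP[z1 z2]; nra.
move: h2; rewrite big_split/= sumr_const card_ord -mulr_suml => h2.
have : y 0 i ^+ 2 <= \sum_j y 0 j ^+ 2.
  by rewrite (bigD1 i)//= lerDl; apply: sumr_ge0 => j _; exact: sqr_ge0.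
move=> h3; rewrite -(@ler_pXn2r _ 2)// ?nnegrE// real_normK ?num_real//.
move: h h2 h3 n1; rewrite -[2 *+ n]mulr_natr; set s := \sum_j _; set s' := \sum_j _; nra.
Qed.

(** [S] stands for the image of a cube of side [h] under a map that is linear up to an error
    [d * h]. The choice of [d] depends on [A] and [eta] but not on the cube, so the loss is at most
    [eta] per unit of volume at every scale. *)
Lemma near_linear_image_bound n (A : 'M[R]_n) (m eta : R) : possemidef A -> 0 <= m -> \det A <= m -> 0 < eta ->
  exists2 d : R, 0 < d & forall (v : 'rV[R]_n) (h : R) (S : set 'rV[R]_n), 0 < h ->
    (forall z, S z -> exists y w : 'rV[R]_n, [/\ (forall i, 0 <= y 0 i <= 1), cbox 0 1 w &
       z = v + h *: (y *m A + d *: w)]) ->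
    (lebn_outer S <= ((m + eta) * h ^+ n)%R%:E)%E.
Proof.
move=> pA m0 Am eta0; have [A0|A0] := eqVneq (\det A) 0.
  (* (A + d I)^-1 maps the d-neighbourhood of the image into a cube of fixed
     size, and det (A + d I) tends to 0. *)
  pose f t := \det (A + t%:M) * ((n%:R *+ 2 + 1) *+ 2) ^+ n.
  have cf : {for 0, continuous f}.
    by apply: cvgM; [exact: det_shift_continuous|exact: cvg_cst].
  have [|d d0] := @continuous_ltr_right f 0 eta cf.
    by rewrite /f (raddf0 scalar_mx) addr0 A0 mul0r.
  rewrite add0r /f => fd; have pB := possemidefD_scalar pA d0.
  exists d => // v h S h0 hS.
  apply: le_trans (_ : _ <= (\det (A + d%:M) * ((n%:R *+ 2 + 1) *+ 2) ^+ n * h ^+ n)%R%:E)%E _; last first.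
    by rewrite lee_fin ler_pM2r ?exprn_gt0// (le_trans (ltW fd))// lerDr.
  apply: le_trans (lebn_outer_affine v pB h0 _); last by rewrite addr_ge0// mulrn_wge0.
  apply: le_lebn_outer => z /hS[y [w [y01 w1 ->]]].
  have uB : A + d%:M \in unitmx by rewrite unitmxE unitfE gt_eqF// posdef_det_gt0.
  (* This point [x] satisfies [(x - y) *m (A + d%:M) = d *: (w - y)], where the coordinates of
     [w - y] are at most 2 in absolute value. Hence [x] lies within [n%:R *+ 2] of [y], which
     accounts for the half-side [n%:R *+ 2 + 1]. *)
  exists ((y *m A + d *: w) *m invmx (A + d%:M)); last by rewrite mulmxKV.
  set x := _ *m invmx _; have : cbox 0 (n%:R *+ 2) (x - y).
    apply: (@shifted_inverse_bound _ A d _ (w - y)) => //.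
      move=> i; have := w1 i; have := y01 i; rewrite !mxE !subr0.
      by rewrite !ler_norml => /andP[? ?] /andP[? ?]; apply/andP; split; lra.
    rewrite mulmxBl mulmxKV// mulmxDr mul_mx_scalar scalerBr.
    by rewrite opprD addrACA subrr add0r.
  move=> hxy i; have := hxy i; have := y01 i; rewrite !mxE !subr0.
  by rewrite !ler_norml => /andP[? ?] /andP[? ?]; apply/andP; split; lra.
(* Invertible case: pulling the error back by the inverse of [A] enlarges the unit cube, of
   half-side [2^-1] around [e], by at most [C * d] on each side. *)
have qA := possemidef_posdef pA A0.
pose C := \sum_i \sum_j `|invmx A i j|.
have C0 : 0 <= C by apply: sumr_ge0 => i _; exact: sumr_ge0.
pose f t := \det A * ((2^-1 + C * t) *+ 2) ^+ n.
have cf : {for 0, continuous f}.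
  rewrite (_ : f = horner ((\det A)%:P * (((2^-1)%:P + C *: 'X) *+ 2) ^+ n)).
    exact: continuous_horner.
  by apply/funext => t; rewrite hornerM hornerC horner_exp hornerMn hornerD hornerC hornerZ hornerX.
have [|d d0] := @continuous_ltr_right f 0 (m + eta) cf.
  rewrite /f mulr0 addr0 (_ : 2^-1 *+ 2 = 1) ?expr1n ?mulr1 ?(le_lt_trans Am) ?ltrDl//.
  by lra.
rewrite add0r /f => fd; exists d => // v h S h0 hS.
apply: le_trans (_ : _ <= (\det A * ((2^-1 + C * d) *+ 2) ^+ n * h ^+ n)%R%:E)%E _; last first.
  by rewrite lee_fin ler_pM2r ?exprn_gt0// ltW.
pose e : 'rV[R]_n := const_mx 2^-1.
apply: le_trans (lebn_outer_affine (v + h *: (e *m A)) qA h0 _); last first.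
  by rewrite addr_ge0// mulr_ge0// ltW.
apply: le_lebn_outer => z /hS[y [w [y01 w1 ->]]].
exists (y - e + d *: (w *m invmx A)); last first.
  rewrite -addrA -scalerDr; congr (_ + _ *: _).
  rewrite !mulmxDl -scalemxAl mulmxKV ?unitmxE ?unitfE// mulNmx.
  by rewrite addrA addrCA subrr addr0.
have := mulmx_cbox0 (invmx A) w1; rewrite mulr1 -/C; move: (w *m invmx A) => W W1 i.
have := W1 i; have := y01 i; rewrite /e !mxE !subr0; set q := W 0 i.
rewrite !ler_norml => /andP[? ?] /andP[? ?].
have h1 : d * q <= C * d by rewrite mulrC ler_pM2r.
have h2 : - (C * d) <= d * q by rewrite -mulNr mulrC ler_pM2l.
by apply/andP; split; lra.
Qed.

(** The error is controlled between any two points near [x], because the small cubes supplied by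
    Cousin's lemma lie near [x] without having [x] as a corner. *)
Definition strict_derivative n (T : 'rV[R]_n -> 'rV[R]_n) (A : 'M[R]_n) x :=
  forall d, 0 < d -> exists2 r, 0 < r & forall a y rho, cbox x r a -> cbox x r y ->
    cbox a rho y -> cbox 0 (d * rho) (T y - T a - (y - a) *m A).

Lemma cube_image_bound n (T : 'rV[R]_n -> 'rV[R]_n) A x (m eta : R) : strict_derivative T A x ->
  possemidef A -> 0 <= m -> \det A <= m -> 0 < eta ->
  exists2 r : R, 0 < r & forall a (h : R), 0 < h -> h <= r -> cbox x r a ->
    (lebn_outer (T @` qcube a h) <= ((m + eta) * h ^+ n)%R%:E)%E.
Proof.
move=> TA pA m0 Am eta0.
have [d d0 hd] := near_linear_image_bound pA m0 Am eta0.
have [r r0 hr] := TA _ d0.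
exists (r / 2) => [|a h h0 hr2 xa]; first by rewrite divr_gt0.
apply: (hd (T a) h) => // _ [y ay <-].
pose err := T y - T a - (y - a) *m A.
have err_le : cbox 0 (d * h) err.
  apply: hr => [i|i|i].
  - by apply: le_trans (xa i) _; lra.
  - have := xa i; have := ay i; rewrite !ler_distl => /andP[? ?] /andP[? ?].
    by apply/andP; split; lra.
  - by have := ay i; rewrite ler_distl => /andP[? ?]; apply/andP; split; lra.
exists (h^-1 *: (y - a)), ((d * h)^-1 *: err); split.
- move=> i; have := ay i; rewrite !mxE => /andP[? ?].
  by rewrite mulrC divr_ge0 ?subr_ge0 ?(ltW h0)//= ler_pdivrMr// mul1r; lra.
- clearbody err => i; have := err_le i; rewrite !mxE !subr0 normrM.
  by rewrite gtr0_norm ?invr_gt0 ?mulr_gt0// ler_pdivrMl ?mulr_gt0// mulr1.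
- rewrite -scalemxAl scalerA scalerDr !scalerA divff ?gt_eqF// scale1r.
  rewrite (_ : h * _ = 1) ?scale1r; first by rewrite [X in T a + X]addrC subrK addrC subrK.
  by field; rewrite !gt_eqF.
Qed.

End images.

(** * The area inequality by subdivision *)

Section image_measure.
Context {R : realType} {n : nat}.

(** The comparison survives subdivision, since outer measure is subadditive and the integral is
    additive over the children. On small cubes near a point of [K] it is [cube_image_bound]; near
    any other point it is trivial because [K] is closed. The last hypothesis is a lower
    semicontinuity condition: it lets the pointwise bound [m] be compared with [g] on a whole
    cube. *)
Lemma image_measure_le (T : 'rV[R]_n -> 'rV[R]_n) (K : set 'rV[R]_n) (g : 'rV[R]_n -> R) a h :
  0 < h -> closed K -> K `<=` qcube a h ->
  (forall x, 0 <= g x) -> measurable_fun setT g ->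
  (forall x, K x -> exists A m, [/\ strict_derivative T A x, possemidef A, 0 <= m, \det A <= m &
      forall eta, 0 < eta -> \forall y \near x, m - eta <= g y]) ->
  (lebn_outer (T @` K) <= \int[lebn n]_x (g x)%:E)%E.
Proof.
move=> h0 cK Kq g0 mg KT; apply/lee_addgt0Pr => e e0.
(* Spreads the total error [e] over the volume of the large cube. Half of [c] absorbs the loss in
   the image bound, the other half the variation of [g]. *)
pose c := e / h ^+ n.
have c0 : 0 < c by rewrite divr_gt0// exprn_gt0.
pose G x := (g x + c)%:E.
have mG : measurable_fun setT G by apply/measurable_EFinP; exact: measurable_funD.
have G0 x : (0 <= G x)%E by rewrite lee_fin addr_ge0// ltW.
pose P b k := (lebn_outer (T @` (K `&` qcube b k)) <= \int[lebn n]_(x in qcube b k) G x)%E.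
have Pall : forall b k, 0 < k -> P b k.
  apply: cousin => [b k k0 Pb|x].
    rewrite /P qcube_children//.
    rewrite ge0_integral_bigsetU//=; [|by move=> *; exact: measurable_qcube|exact: index_enum_uniq| | ]; last 2 first.
    - exact: (sub_trivIset (subsetT _) (@trivIset_children R n b k k0)).
    - exact: measurable_funTS.
    rewrite (_ : T @` _ = \big[setU/set0]_(e <- index_enum {ffun 'I_n -> bool})
        (T @` (K `&` qcube (child b k e) (k / 2)))); last first.
      by rewrite -!bigcup_seq setI_bigcupr image_bigcup.
    apply: le_trans (lebn_outer_bigsetU _ _) _.
    by apply: lee_sum => i _; exact: Pb.
  have [Kx|nKx] := pselect (K x); last first.
    have /nbhs_cboxP[r r0 hr] : nbhs x (~` K) by apply: open_nbhs_nbhs; split => //; exact: closed_openC.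
    exists (r / 2) => [|b k k0 kr xb]; first by rewrite divr_gt0.
    rewrite /P (_ : K `&` _ = set0) ?image_set0.
      by rewrite lebn_outerE// measure0 integral_ge0.
    rewrite -subset0 => y [Ky by_]; apply: hr Ky => i.
    have := by_ i; have := xb i; rewrite !ler_distl => /andP[? ?] /andP[? ?].
    by apply/andP; split; lra.
  have [A [m [TA pA m0 Am gm]]] := KT _ Kx.
  have c2 : 0 < c / 2 by rewrite divr_gt0.
  have [r r0 hr] := cube_image_bound TA pA m0 Am c2.
  have /nbhs_cboxP[s s0 hs] := gm _ c2.
  exists (Num.min r (s / 2)) => [|b k k0]; first by rewrite lt_min r0 divr_gt0.
  rewrite le_min => /andP[kr ks] xb.
  have xb' i : `|b 0 i - x 0 i| <= r /\ `|b 0 i - x 0 i| <= s / 2.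
    by apply/andP; have := xb i; rewrite le_min.
  apply: le_trans (le_lebn_outer _) _.
    by apply: image_subset; exact: subIsetr.
  apply: le_trans (hr b k k0 kr (fun i => (xb' i).1)) _.
  rewrite [leLHS](_ : _ = (\int[lebn n]_(x in qcube b k) (m + c / 2)%:E)%E); last first.
    rewrite integral_cst; last exact: measurable_qcube.
    by rewrite EFinM; congr (_ * _)%E; exact/esym/lebn_qcube/ltW.
  apply: ge0_le_integral => //.
  - exact: measurable_qcube.
  - by move=> y _; rewrite lee_fin addr_ge0// ltW.
  - exact: measurable_funTS.
  - move=> y yb; rewrite lee_fin; suff : m - c / 2 <= g y by lra.
    apply: hs => i; have := yb i; have := (xb' i).2; rewrite !ler_distl => /andP[? ?] /andP[? ?].
    by apply/andP; split; lra.
have := Pall a h h0; rewrite /P setIidl// => /le_trans; apply.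
rewrite /G; under eq_integral do rewrite EFinD.
have mq := measurable_qcube a h.
have mg' : measurable_fun (qcube a h) (fun x => (g x)%:E).
  by apply: measurable_funTS; exact/measurable_EFinP.
rewrite ge0_integralD//; [|by move=> x _; rewrite lee_fin|by move=> x _; rewrite lee_fin ltW].
apply: leeD.
  apply: ge0_subset_integral => //; first exact/measurable_EFinP.
  by move=> x _; rewrite lee_fin.
rewrite integral_cst// [X in (_ * X)%E](_ : _ = (h ^+ n)%:E); last exact/lebn_qcube/ltW.
by rewrite -EFinM lee_fin /c divfK// gt_eqF// exprn_gt0.
Qed.

End image_measure.

(** * Functions of class C^1 and C^2 *)

Section dotv.
Context {R : realType} {n : nat}.
Implicit Types (x y v w : 'rV[R]_n).

Lemma dotvDl x y v : dotv (x + y) v = dotv x v + dotv y v.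
Proof. by rewrite /dotv -big_split; apply: eq_bigr => i _; rewrite mxE mulrDl. Qed.

Lemma dotvC x v : dotv x v = dotv v x.
Proof. by apply: eq_bigr => i _; rewrite mulrC. Qed.

Lemma dotvDr x y v : dotv v (x + y) = dotv v x + dotv v y.
Proof. by rewrite dotvC dotvDl !(dotvC v). Qed.

Lemma dotvZl (c : R) x v : dotv (c *: x) v = c * dotv x v.
Proof. by rewrite /dotv mulr_sumr; apply: eq_bigr => i _; rewrite mxE mulrA. Qed.

Lemma dotvZr (c : R) x v : dotv v (c *: x) = c * dotv v x.
Proof. by rewrite dotvC dotvZl dotvC. Qed.

Lemma dotvNl x v : dotv (- x) v = - dotv x v.
Proof. by rewrite -scaleN1r dotvZl mulN1r. Qed.

Lemma dotvNr x v : dotv v (- x) = - dotv v x.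
Proof. by rewrite dotvC dotvNl dotvC. Qed.

Lemma dotv0 v : dotv v 0 = 0.
Proof. by rewrite /dotv big1// => i _; rewrite mxE mulr0. Qed.

Lemma dotv_ge0 x : 0 <= dotv x x.
Proof. by apply: sumr_ge0 => i _; rewrite -expr2 sqr_ge0. Qed.

Lemma dotv_eq0 x : dotv x x = 0 -> x = 0.
Proof.
move=> x0; apply/rowP => i; rewrite mxE; apply/eqP; rewrite -sqrf_eq0 expr2; apply/eqP.
by apply: (psumr_eq0P (F := fun i => x 0 i * x 0 i)) x0 _ _ => // j _; rewrite -expr2 sqr_ge0.
Qed.

Lemma dotv_delta x (i : 'I_n) : dotv (delta_mx 0 i) x = x 0 i.
Proof.
rewrite /dotv (bigD1 i)//= mxE !eqxx mul1r big1 ?addr0// => j ji.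
by rewrite mxE (negbTE ji) andbF mul0r.
Qed.

Lemma dotv_mulmx x v : (x *m v^T) 0 0 = dotv x v.
Proof. by rewrite mxE; apply: eq_bigr => i _; rewrite mxE. Qed.

Lemma dotv_cbox v w (r : R) : cbox 0 r w -> `|dotv w v| <= r * \sum_i `|v 0 i|.
Proof.
move=> hw; apply: le_trans (ler_norm_sum _ _ _) _; rewrite mulr_sumr.
by apply: ler_sum => i _; have := hw i; rewrite mxE subr0 normrM => ?; rewrite ler_wpM2r.
Qed.

End dotv.

(** * Mean value theorem on lines and strict differentiability *)

Section strict_differentiability.
Context {R : realType} {n : nat}.
Implicit Types (f u : 'rV[R]_n -> R) (x y a v : 'rV[R]_n).

Lemma is_derive_line f y v (s : R) : derivable f (y + s *: v) v ->
  is_derive s 1 (fun t : R => f (y + t *: v)) ('D_v f (y + s *: v)).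
Proof.
move=> df; have E : (fun h : R => h^-1 *: (((fun t : R => f (y + t *: v)) \o shift s) (h *: (1 : R)) - f (y + s *: v)))
  = (fun h : R => h^-1 *: ((f \o shift (y + s *: v)) (h *: v) - f (y + s *: v))).
  apply/funext => h /=; congr (_ *: (f _ - _)).
  by rewrite [h *: 1]mulr1 scalerDl addrCA.
by split; rewrite /derivable /derive E.
Qed.

Lemma line_MVT f y v (t : R) : 0 < t ->
  (forall s, 0 < s < t -> derivable f (y + s *: v) v) ->
  {within `[0, t], continuous (fun s : R => f (y + s *: v))} ->
  exists2 s, 0 < s < t & f (y + t *: v) - f y = t * 'D_v f (y + s *: v).
Proof.
move=> t0 df cf.
have [|s] := MVT (df := fun s => 'D_v f (y + s *: v)) t0 _ cf.
  by move=> s; rewrite in_itv/= => /df; exact: is_derive_line.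
rewrite in_itv/= scale0r addr0 subr0 mulrC => st E; by exists s.
Qed.

Lemma line_MVT_closed f y v (t : R) : 0 < t ->
  (forall s, 0 <= s <= t -> derivable f (y + s *: v) v) ->
  exists2 s, 0 < s < t & f (y + t *: v) - f y = t * 'D_v f (y + s *: v).
Proof.
move=> t0 df; apply: line_MVT => //.
  by move=> s /andP[s0 st]; apply: df; rewrite !ltW.
apply: derivable_within_continuous => s; rewrite in_itv/= => /df.
by move=> /is_derive_line[].
Qed.

Lemma line_MVT_signed f y v (t : R) :
  (forall s, `|s| <= `|t| -> derivable f (y + s *: v) v) ->
  exists2 s, `|s| <= `|t| & f (y + t *: v) - f y = t * 'D_v f (y + s *: v).
Proof.
move=> df; have [t0|t0|<-] := ltgtP 0 t.
- have [|s /andP[s0 st] E] := @line_MVT_closed f y v t t0.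
    by move=> s /andP[s0 st]; apply: df; rewrite !ger0_norm// ltW.
  by exists s => //; rewrite !gtr0_norm// ltW.
- have [||s /andP[s0 st] E] := @line_MVT_closed f (y + t *: v) v (- t).
  + by rewrite oppr_gt0.
  + move=> s /andP[s0 st]; rewrite -addrA -scalerDl; apply: df.
    by rewrite !ler0_norm ?(ltW t0)//; lra.
  + exists (t + s); first by rewrite !ler0_norm ?(ltW t0)//; lra.
    move: E; rewrite -!addrA -!scalerDl subrr scale0r addr0 mulNr => E.
    by rewrite -opprB E opprK.
- by exists 0; rewrite ?normr0// scale0r addr0 subrr mul0r.
Qed.

Lemma finite_radius (P : 'I_n -> R -> Prop) :
  (forall j (r s : R), 0 < s -> s <= r -> P j r -> P j s) ->
  (forall j, exists2 r, 0 < r & P j r) -> exists2 r, 0 < r & forall j, P j r.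
Proof.
move=> Pmono Pex.
have [r rP] := choice (fun j => let: ex_intro2 r r0 Pr := Pex j in ex_intro _ r (conj r0 Pr)).
have m0 : 0 < \big[Num.min/1]_j r j.
  by elim/big_rec: _ => // j s _ s0; rewrite lt_min s0 (rP j).1.
exists (\big[Num.min/1]_j r j) => // j.
by apply: Pmono (rP j).2 => //; rewrite (bigD1 j)//= ge_min lexx.
Qed.

Definition strict_gradient f x (p : 'rV[R]_n) :=
  forall d, 0 < d -> exists2 r, 0 < r & forall a y rho, 0 <= rho -> cbox x r a -> cbox x r y ->
    cbox a rho y -> `|f y - f a - dotv (y - a) p| <= d * rho.

(** Telescoping along these points splits an increment into increments in one coordinate, each
    accessible through a partial derivative. *)
Definition mix a y (k : nat) : 'rV[R]_n := \row_j (if (j < k)%N then y 0 j else a 0 j).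

Lemma mixS a y (k : 'I_n) :
  mix a y k.+1 = mix a y k + (y 0 k - a 0 k) *: delta_mx 0 k.
Proof.
apply/rowP => j; rewrite !mxE eqxx/= ltnS leq_eqVlt.
have [->|jk] := eqVneq j k; first by rewrite eqxx/= ltnn mulr1 addrC subrK.
by rewrite (negbTE jk : (j == k :> nat) = false)/= mulr0 addr0.
Qed.

Lemma telescope_mix f a y :
  f y - f a = \sum_(k < n) (f (mix a y k + (y 0 k - a 0 k) *: delta_mx 0 k) - f (mix a y k)).
Proof.
have -> : f y - f a = f (mix a y n) - f (mix a y 0).
  by congr (f _ - f _); apply/rowP => j; rewrite mxE ?ltn_ord.
rewrite -(telescope_sumr (fun k => f (mix a y k)))// big_mkord.
by apply: eq_bigr => k _; rewrite mixS.
Qed.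

Lemma strict_gradient_partial f x : (\forall y \near x, forall j, derivable f y (delta_mx 0 j)) ->
  (forall j, {for x, continuous (partial j f)}) -> strict_gradient f x (grad f x).
Proof.
move=> /nbhs_cboxP[r0 r0_gt0 df] cf d d0.
(* Each of the [n] coordinate steps may contribute [e * rho]; [n.+1] keeps the denominator positive
   when [n = 0]. *)
pose e := d / n.+1%:R; have e0 : 0 < e by rewrite divr_gt0.
have [r r_gt0 hr] : exists2 r, 0 < r & forall j, cbox x r `<=` [set y | `|partial j f y - partial j f x| <= e].
  apply: finite_radius => [j r s s0 sr rP y ys|j]; first by apply: rP => i; exact: le_trans sr.
  apply/nbhs_cboxP; have : \forall y \near x, `|partial j f x - partial j f y| <= e.
    by have /cvgrPdist_le := cf j; exact.
  by apply: filterS => y /=; rewrite distrC.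
pose s := Num.min r r0; have s_gt0 : 0 < s by rewrite lt_min r_gt0.
(* A point on a coordinate segment is off by at most [s / 3] at the base point plus [2 * s / 3], the
   largest possible distance of [y 0 k] from [a 0 k]. *)
exists (s / 3) => [|a y rho rho0 xa xy ay]; first by rewrite divr_gt0.
have near_mix k (q : R) : `|q| <= `|y 0 k - a 0 k| ->
    cbox x s (mix a y k + q *: delta_mx 0 k).
  move=> hq i; rewrite !mxE eqxx/=; have := xa i; have := xy i; have := xa k; have := xy k.
  move: hq; set z := if _ then _ else _.
  have zc : z = y 0 i \/ z = a 0 i by rewrite /z; case: ifP; [left|right].
  case: (eqVneq i k) zc => [->|_] zc; last first.
    by move=> _ _ _; rewrite mulr0 addr0; case: zc => ->; lra.
  rewrite mulr1 => hq h1 h2 _ _.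
  have h3 : `|q| <= s / 3 + s / 3.
    rewrite (le_trans hq)// (le_trans (ler_distD (x 0 k) _ _))// lerD//.
    by rewrite distrC.
  move: h1 h2 h3; rewrite !ler_norml => /andP[? ?] /andP[? ?] /andP[? ?].
  by apply/andP; case: zc => ->; split; lra.
have sr z : cbox x s z -> cbox x r z by move=> h j; rewrite (le_trans (h j))// ge_min lexx.
have sr0 z : cbox x s z -> cbox x r0 z by move=> h j; rewrite (le_trans (h j))// ge_min lexx orbT.
rewrite telescope_mix /dotv -sumrB; apply: le_trans (ler_norm_sum _ _ _) _.
apply: (@le_trans _ _ (\sum_(i < n) e * rho)); last first.
  rewrite sumr_const card_ord -mulr_natr mulrAC ler_wpM2r// /e.
  by rewrite mulrAC ler_pdivrMr// ler_pM2l// ler_nat.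
apply: ler_sum => k _.
have [|q hq ->] := @line_MVT_signed f (mix a y k) (delta_mx 0 k) (y 0 k - a 0 k).
  by move=> q hq; apply: df; exact/sr0/near_mix.
rewrite !mxE -mulrBr normrM mulrC; apply: ler_pM => //.
by apply: hr; exact/sr/near_mix.
Qed.

Lemma strict_gradient_derive f x p v : strict_gradient f x p ->
  is_derive x v f (dotv v p).
Proof.
move=> fp.
have h : (fun h : R => h^-1 *: ((f \o shift x) (h *: v) - f x)) @ 0^' --> dotv v p.
  apply/cvgrPdist_le => e e0.
  pose M := 1 + \sum_i `|v 0 i|.
  have M0 : 0 < M by rewrite ltr_wpDr ?sumr_ge0.
  have vM i : `|v 0 i| <= M.
    by rewrite /M (bigD1 i)//= addrCA lerDl addr_ge0// sumr_ge0.
  have [r r0 hr] := fp (e / M) (divr_gt0 e0 M0).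
  near=> h => /=.
  have h0 : h != 0 by near: h; exact: nbhs_dnbhs_neq.
  have hM : `|h| * M <= r.
    rewrite -ler_pdivlMr//; near: h; apply: dnbhs0_le; exact: divr_gt0.
  have := hr x (h *: v + x) (`|h| * M) (mulr_ge0 (normr_ge0 _) (ltW M0)) (cbox_center _ (ltW r0)).
  have hx : cbox x (`|h| * M) (h *: v + x).
    by move=> i; rewrite !mxE addrK normrM ler_wpM2l.
  have hxr : cbox x r (h *: v + x) by move=> i; exact: le_trans (hx i) hM.
  move=> /(_ hxr hx); rewrite addrK.
  have -> : dotv (h *: v) p = h * dotv v p.
    by rewrite /dotv mulr_sumr; apply: eq_bigr => i _; rewrite mxE mulrA.
  have -> : e / M * (`|h| * M) = `|h| * e by field; rewrite gt_eqF.
  set D := f _ - f x => hD.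
  rewrite -(@ler_pM2l _ `|h|) ?normr_gt0// -normrM mulrBr /GRing.scale/= mulrA divff// mul1r.
  by rewrite distrC.
split; first by apply/cvg_ex; exists (dotv v p).
exact: cvg_lim h.
Unshelve. all: by end_near.
Qed.

End strict_differentiability.

(** * The Hessian: symmetry and minimum conditions *)

Section hessian.
Context {R : realType} {n : nat}.
Variables (Om : set 'rV[R]_n) (Om_open : open Om).
Implicit Types (f u : 'rV[R]_n -> R) (x y a v p : 'rV[R]_n).

Lemma Ck1_strict_gradient f x : Ck 1 Om f -> Om x -> strict_gradient f x (grad f x).
Proof.
move=> [_ cf] Ox; apply: strict_gradient_partial => [|j]; last by apply: (cf j).2.1.
by apply: filterS (open_nbhs_nbhs (conj Om_open Ox)) => y Oy j; exact: (cf j).1.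
Qed.

Lemma Ck1_is_derive f x v : Ck 1 Om f -> Om x -> is_derive x v f (dotv v (grad f x)).
Proof. by move=> cf Ox; apply: strict_gradient_derive; exact: Ck1_strict_gradient. Qed.

Lemma Ck2_Ck1 u : Ck 2 Om u -> Ck 1 Om u.
Proof. by move=> [cu c2]; split => // i; have [h [h' _]] := c2 i; split. Qed.

Lemma Ck2_partial u i : Ck 2 Om u -> Ck 1 Om (partial i u).
Proof. by move=> [_ /(_ i)[]]. Qed.

Definition hess u x : 'M[R]_n := \matrix_(i, j) partial i (partial j u) x.

Lemma mxtrace_hess u x : \tr (hess u x) = laplacian u x.
Proof. by apply: eq_bigr => i _; rewrite mxE. Qed.

Lemma grad_strict_derivative u x : Ck 2 Om u -> Om x ->
  strict_derivative (grad u) (hess u x) x.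
Proof.
move=> cu Ox d d0.
have [r r0 hr] : exists2 r, 0 < r & forall j, forall a y rho, 0 <= rho -> cbox x r a -> cbox x r y ->
    cbox a rho y -> `|partial j u y - partial j u a - dotv (y - a) (grad (partial j u) x)| <= d * rho.
  apply: finite_radius => [j r s s0 sr rP a y rho rho0 xa xy|j].
    by apply: rP => // i; [exact: le_trans (xa i) _|exact: le_trans (xy i) _].
  exact: (Ck1_strict_gradient (Ck2_partial j cu) Ox).
exists r => // a y rho xa xy ay j.
have rho0 : 0 <= rho by apply: le_trans (ay j).
have := hr j a y rho rho0 xa xy ay; congr (`| _ | <= _).
rewrite !mxE subr0; congr (_ - _).
by apply: eq_bigr => i _; rewrite !mxE.
Qed.

Lemma is_derive_translate f y v w : derivable f (y + w) v ->
  is_derive y v (fun z => f (z + w)) ('D_v f (y + w)).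
Proof.
move=> df; have E : (fun h : R => h^-1 *: (((fun z => f (z + w)) \o shift y) (h *: v) - f (y + w)))
  = (fun h : R => h^-1 *: ((f \o shift (y + w)) (h *: v) - f (y + w))).
  by apply/funext => h /=; rewrite addrA.
by split; rewrite /derivable /derive E.
Qed.

(** The second difference is the increment in direction [i] of [F], itself a difference in direction
    [j]. The mean value theorem turns it into [t] times an increment of [partial i u], which strict
    differentiability of the gradient evaluates. *)
Lemma second_difference u x i j d : Ck 2 Om u -> Om x -> 0 < d ->
  \forall t \near 0^'+, `|u (x + t *: delta_mx 0 j + t *: delta_mx 0 i) - u (x + t *: delta_mx 0 i)
     - u (x + t *: delta_mx 0 j) + u x - t ^+ 2 * hess u x j i| <= d * t ^+ 2.
Proof.
move=> cu Ox d0.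
have /nbhs_cboxP[r0 r0_gt0 hr0] : nbhs x Om by exact: open_nbhs_nbhs.
have [r r_gt0 hr] := grad_strict_derivative cu Ox d0.
near=> t.
have t0 : 0 < t by near: t; exact: nbhs_right_gt.
have tr : t <= r / 2 by near: t; apply: nbhs_right_le; exact: divr_gt0.
have tr0 : t <= r0 / 2 by near: t; apply: nbhs_right_le; exact: divr_gt0.
set ei := delta_mx 0 i; set ej := delta_mx 0 j.
have dc k l : `|(delta_mx 0 k : 'rV[R]_n) 0 l| <= 1.
  by rewrite mxE; case: (_ && _); rewrite ?normr1 ?normr0.
have in_box (q s : R) rr : 0 <= q <= t -> 0 <= s <= t -> t <= rr / 2 -> cbox x rr (x + s *: ei + q *: ej).
  move=> /andP[q0 qt] /andP[s0 st] tt l; rewrite !mxE -addrA [x 0 l + _]addrC addrK.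
  rewrite (le_trans (ler_normD _ _))// !normrM (ger0_norm s0) (ger0_norm q0).
  have := dc i l; have := dc j l; rewrite !mxE => h1 h2.
  by rewrite (le_trans (lerD (ler_piMr s0 h2) (ler_piMr q0 h1)))//; lra.
have t01 : 0 <= t <= t by rewrite (ltW t0) lexx.
have z01 : (0 : R) <= 0 <= t by rewrite (ltW t0) lexx.
pose F y := u (y + t *: ej) - u y.
have dF s : 0 <= s <= t -> is_derive (x + s *: ei) ei F
     (partial i u (x + s *: ei + t *: ej) - partial i u (x + s *: ei)).
  move=> s01; apply: is_deriveB.
    apply: is_derive_translate; have [_ /(_ i)[h _]] := cu; apply: h; apply: hr0.
    exact: in_box.
  have [_ /(_ i)[h _]] := cu; apply: DeriveDef => //; apply: h; apply: hr0.
  by have := in_box 0 s _ z01 s01 tr0; rewrite scale0r addr0.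
have [s /dF|s /andP[s0 st] E] := @line_MVT_closed _ _ F x ei t t0; first by case.
have s01 : 0 <= s <= t by rewrite !ltW.
have h := hr (x + s *: ei) (x + s *: ei + t *: ej) t.
have {}h := h _ (in_box _ _ _ t01 s01 tr) _ i.
have {h} := h _ _.
have b1 : cbox x r (x + s *: ei) by have := in_box 0 s _ z01 s01 tr; rewrite scale0r addr0.
have b2 y : cbox y t (y + t *: ej).
  move=> l; have := dc j l; rewrite !mxE [y 0 l + _]addrC addrK normrM (ger0_norm (ltW t0)).
  exact: ler_piMr (ltW t0).
move=> /(_ b1 (b2 _)).
rewrite [X in `|X| <= d * t](_ : _ = partial i u (x + s *: ei + t *: ej) -
    partial i u (x + s *: ei) - t * hess u x j i); last first.
  by rewrite [x + s *: ei + _]addrC addrK -scalemxAl -rowE !mxE subr0.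
have [_ DE] := dF s s01; rewrite DE in E.
rewrite (_ : u _ - _ - _ + _ = F (x + t *: ei) - F x); last first.
  by rewrite /F [x + _ + t *: ei]addrAC; ring.
rewrite E (_ : t * _ - t ^+ 2 * _ = t * (partial i u (x + s *: ei + t *: ej) -
    partial i u (x + s *: ei) - t * hess u x j i)); last by ring.
by rewrite normrM (ger0_norm (ltW t0)) expr2 [d * (_ * _)]mulrCA ler_pM2l.
Unshelve. all: by end_near.
Qed.

(** The second difference is symmetric in the two directions, so it approximates both mixed
    derivatives after division by [t ^+ 2]. *)
Lemma hess_sym u x : Ck 2 Om u -> Om x -> (hess u x)^T = hess u x.
Proof.
move=> cu Ox; apply/matrixP => i j; rewrite mxE; apply/eqP.
rewrite -subr_eq0 -normr_le0; apply/ler_addgt0Pr => e e0; rewrite add0r.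
have e2 : 0 < e / 2 by rewrite divr_gt0.
near (0 : R)^'+ => t.
have t0 : 0 < t by near: t; exact: nbhs_right_gt.
have h1 : `|u (x + t *: delta_mx 0 j + t *: delta_mx 0 i) - u (x + t *: delta_mx 0 i)
     - u (x + t *: delta_mx 0 j) + u x - t ^+ 2 * hess u x j i| <= e / 2 * t ^+ 2.
  by near: t; exact: second_difference.
have h2 : `|u (x + t *: delta_mx 0 i + t *: delta_mx 0 j) - u (x + t *: delta_mx 0 j)
     - u (x + t *: delta_mx 0 i) + u x - t ^+ 2 * hess u x i j| <= e / 2 * t ^+ 2.
  by near: t; exact: second_difference.
rewrite -(@ler_pM2r _ (t ^+ 2)) ?exprn_gt0//.
rewrite -[X in _ * X]ger0_norm ?sqr_ge0// -normrM.
rewrite [x + _ + t *: delta_mx 0 j]addrAC in h2.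
move: h1 h2; set a := u _; set b := u _; set c := u _; set D := u _.
move: (t ^+ 2) (hess u x j i) (hess u x i j) => T p q.
rewrite !ler_norml => /andP[? ?] /andP[? ?]; apply/andP; split; lra.
Unshelve. all: by end_near.
Qed.

(** For the gradient, a small step along [p - grad u x] would otherwise decrease [u - p]. For the
    Hessian, no Taylor formula is used: the mean value theorem gives a point [x + s *: v] where the
    derivative along [v] is at least [dotv p v], and expanding the gradient there leaves [s] times
    the form, up to an error at most [e * s]. *)
Lemma minimum_second_order u x p : Ck 2 Om u -> Om x ->
  (forall y, Om y -> u x + dotv p (y - x) <= u y) ->
  grad u x = p /\ possemidef (hess u x).
Proof.
move=> cu Ox minx.
have /nbhs_cboxP[r0 r0_gt0 hr0] : nbhs x Om by exact: open_nbhs_nbhs.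
have line v : exists2 M, 0 < M & forall t, 0 <= t -> cbox x (t * M) (x + t *: v).
  exists (1 + \sum_i `|v 0 i|) => [|t t0 i]; first by rewrite ltr_wpDr ?sumr_ge0.
  rewrite !mxE [x 0 i + _]addrC addrK normrM (ger0_norm t0) ler_wpM2l//.
  by rewrite (bigD1 i)//= addrCA lerDl addr_ge0// sumr_ge0.
have gp : grad u x = p.
  apply/eqP; rewrite -subr_eq0; apply/eqP/dotv_eq0/eqP.
  rewrite eq_le dotv_ge0 andbT; set v := grad u x - p.
  have [M M0 hM] := line (- v).
  apply/ler_addgt0Pr => e e0; rewrite add0r.
  have [r r_gt0 hr] := Ck1_strict_gradient (Ck2_Ck1 cu) Ox (divr_gt0 e0 M0).
  pose t := Num.min r r0 / M.
  have t0 : 0 < t by rewrite divr_gt0// lt_min r_gt0.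
  have tM : t * M = Num.min r r0 by rewrite divfK// gt_eqF.
  have h := hM t (ltW t0).
  have hr1 : cbox x r (x + t *: - v) by move=> i; rewrite (le_trans (h i))// tM ge_min lexx.
  have hO : Om (x + t *: - v) by apply: hr0 => i; rewrite (le_trans (h i))// tM ge_min lexx orbT.
  have := hr x (x + t *: - v) _ (mulr_ge0 (ltW t0) (ltW M0)) (cbox_center _ (ltW r_gt0)) hr1 h.
  have := minx _ hO; rewrite [x + _]addrC addrK !dotvZl !dotvZr !dotvNr !dotvNl.
  rewrite (_ : e / M * (t * M) = e * t); last by field; rewrite gt_eqF.
  rewrite ler_norml => h1 /andP[h2 h3].
  have : t * dotv v v <= e * t.
    have -> : dotv v v = dotv v (grad u x) - dotv p v.
      by rewrite {2}/v dotvDr dotvNr [dotv v p]dotvC.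
    by move: h1 h2 h3; lra.
  by rewrite mulrC ler_pM2r.
split => //; split; first exact: hess_sym.
move=> v; have [M M0 hM] := line v.
pose S := 1 + \sum_i `|v 0 i|.
have S0 : 0 < S by rewrite ltr_wpDr ?sumr_ge0.
rewrite -oppr_le0; apply/ler_addgt0Pr => e e0; rewrite add0r.
have [r r_gt0 hr] := grad_strict_derivative cu Ox (divr_gt0 e0 (mulr_gt0 M0 S0)).
pose t := Num.min r r0 / M.
have t0 : 0 < t by rewrite divr_gt0// lt_min r_gt0.
have tM : t * M = Num.min r r0 by rewrite divfK// gt_eqF.
have hs s : 0 <= s <= t -> cbox x (Num.min r r0) (x + s *: v).
  by move=> /andP[s0 st] i; rewrite (le_trans (hM s s0 i))// -tM ler_wpM2r// ltW.
have hsr s : 0 <= s <= t -> cbox x r (x + s *: v).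
  by move=> /hs h i; rewrite (le_trans (h i))// ge_min lexx.
have hsO s : 0 <= s <= t -> Om (x + s *: v).
  by move=> /hs h; apply: hr0 => i; rewrite (le_trans (h i))// ge_min lexx orbT.
have [|s /andP[s0 st] E] := @line_MVT_closed _ _ u x v t t0.
  by move=> w st; have [] := Ck1_is_derive v (Ck2_Ck1 cu) (hsO w st).
have s01 : 0 <= s <= t by rewrite !ltW.
have [_ DE] := Ck1_is_derive v (Ck2_Ck1 cu) (hsO s s01).
have t01 : 0 <= t <= t by rewrite (ltW t0) lexx.
have := minx _ (hsO t t01); rewrite -lerBrDl E DE [x + t *: v]addrC addrK dotvZr ler_pM2l//.
rewrite -gp dotvC => h.
have := hr x (x + s *: v) (s * M) (cbox_center _ (ltW r_gt0)) (hsr s s01) (hM s (ltW s0)).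
set err := (X in cbox 0 _ X).
have errE : grad u (x + s *: v) = grad u x + s *: (v *m hess u x) + err.
  have cancel (a b c : 'rV[R]_n) : a = b + c + (a - b - c).
    by rewrite -[a - b - c]addrA -opprD [RHS]addrC subrK.
  by rewrite /err [x + s *: v - x]addrC addKr scalemxAl -cancel.
clearbody err; move=> /(dotv_cbox v); rewrite errE in h.
move: h; rewrite !dotvDr dotvZr -addrA lerDl => h.
have qE : qform (hess u x) v = dotv v (v *m hess u x) by rewrite /qform dotv_mulmx dotvC.
rewrite qE [dotv err v]dotvC ler_norml => /andP[_ h2].
have h3 : e / (M * S) * (s * M) * \sum_i `|v 0 i| <= e * s.
  rewrite (_ : e / (M * S) * (s * M) = e * s / S); last by field; rewrite !gt_eqF.
  by rewrite mulrAC ler_pdivrMr// ler_pM2l ?mulr_gt0// lerDr.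
have : - (s * dotv v (v *m hess u x)) <= e * s by lra.
by rewrite -mulrN mulrC ler_pM2r.
Qed.

End hessian.

(** * Euclidean norm and limits *)

Section euclidean_norm.
Context {R : realType} {n : nat}.
Implicit Types (x y v p : 'rV[R]_n).

Lemma enorm_ge0 x : 0 <= enorm x. Proof. exact: sqrtr_ge0. Qed.

Lemma sqr_enorm x : enorm x ^+ 2 = dotv x x.
Proof. by rewrite /enorm sqr_sqrtr// dotv_ge0. Qed.

Lemma enormZ (c : R) x : enorm (c *: x) = `|c| * enorm x.
Proof. by rewrite /enorm dotvZl dotvZr mulrA -expr2 sqrtrM ?sqr_ge0// sqrtr_sqr. Qed.

Lemma dotv_le_enorm p v : enorm v = 1 -> dotv p v <= enorm p.
Proof.
move=> v1; have vv : dotv v v = 1 by rewrite -sqr_enorm v1 expr1n.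
have := dotv_ge0 (p - dotv p v *: v).
rewrite dotvDl !dotvDr !dotvNl !dotvNr !dotvZl !dotvZr vv (dotvC v p) -sqr_enorm => h.
have [h0|/ltW h0] := leP 0 (dotv p v); last by rewrite (le_trans h0)// enorm_ge0.
rewrite -(@ler_pXn2r _ 2)// ?nnegrE ?enorm_ge0//; move: h; rewrite expr2; lra.
Qed.

Lemma coord_le_enorm x i : `|x 0 i| <= enorm x.
Proof.
rewrite -(@ler_pXn2r _ 2)// ?nnegrE ?enorm_ge0// real_normK ?num_real// sqr_enorm.
rewrite /dotv (bigD1 i)//= -expr2 lerDl.
by apply: sumr_ge0 => j _; rewrite -expr2 sqr_ge0.
Qed.

Lemma cvg_dotv (T : Type) (F : set_system T) (FF : Filter F) (f g : T -> 'rV[R]_n) x y :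
  f @ F --> x -> g @ F --> y -> (fun t => dotv (f t) (g t)) @ F --> dotv x y.
Proof.
move=> fx gy; rewrite /dotv; apply: cvg_big => [|i _]; first exact: add_continuous.
apply: cvgM.
  exact: (cvg_comp f (fun M : 'rV[R]_n => M 0 i) fx (@coord_continuous R 1 n 0 i x)).
exact: (cvg_comp g (fun M : 'rV[R]_n => M 0 i) gy (@coord_continuous R 1 n 0 i y)).
Qed.

Lemma within_continuousP (T : topologicalType) (S : topologicalType) (A : set T) (f : T -> S) :
  {within A, continuous f} <-> forall x : T, A x -> f @ within A (nbhs x) --> f x.
Proof. exact: subspace_continuousP. Qed.

Lemma closed_cbox x M : closed (cbox x M).
Proof.
rewrite (_ : cbox x M = \bigcap_(i in [set: 'I_n]) [set y : 'rV[R]_n | `|y 0 i - x 0 i| <= M]).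
  apply: closed_bigI => i _; apply: (@closed_comp _ _ (fun y : 'rV[R]_n => `|y 0 i - x 0 i|) [set z | z <= M]).
    move=> y _; apply: (@continuous_comp _ _ _ (fun y : 'rV[R]_n => y 0 i - x 0 i) Num.norm).
      apply: (@cvgB _ _ _ (nbhs y) _ (fun y : 'rV[R]_n => y 0 i) (fun=> x 0 i)); last exact: cvg_cst.
      exact: coord_continuous.
    exact: norm_continuous.
  exact: closed_le.
by apply/seteqP; split => [y hy i _ /=|y hy i]; exact: hy.
Qed.

Lemma cvg_within_id (T : topologicalType) (A : set T) (x : T) : within A (nbhs x) --> x.
Proof. exact: cvg_within. Qed.

Lemma rV_norm_leP x M : 0 <= M -> (`|x| <= M) <-> (forall i, `|x 0 i| <= M).
Proof.
move=> M0; rewrite /Num.norm/= mx_normrE; split => [/bigmax_leP[_ h] i|h].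
  exact: (h (0, i) isT).
by apply/bigmax_leP; split => // -[i j] _; rewrite (ord1 i); exact: h.
Qed.

End euclidean_norm.

(** * Euclidean balls and their volume *)

Section balls.
Context {R : realType} {n : nat}.
Implicit Types (x y v p : 'rV[R]_n).

Lemma measurable_fun_open_continuous (O : set 'rV[R]_n) (f : 'rV[R]_n -> R) : open O ->
  (forall x, O x -> {for x, continuous f}) -> measurable_fun O f.
Proof.
move=> oO cf; apply: (measurability _ (RGenOInfty.measurableE R)) => _ [_ [c ->] <-].
apply: open_measurable_rV; rewrite openE => x [Ox fx].
have fx' : c < f x by move: fx; rewrite /= in_itv/= andbT.
have h1 : \forall y \near x, c < f y by apply: cvgr_gt (cf x Ox) _ fx'.
have h2 : \forall y \near x, O y by exact: open_nbhs_nbhs.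
rewrite /interior; near=> y; split; first by near: y.
by rewrite /= in_itv/= andbT; near: y.
Unshelve. all: by end_near.
Qed.

Lemma enorm_continuous : continuous (@enorm R n).
Proof.
move=> x; apply: (@continuous_comp _ _ _ (fun x => dotv x x) Num.sqrt).
  by apply: (@cvg_dotv R n _ (nbhs x) _ id id x x); exact: cvg_id.
exact: sqrt_continuous.
Qed.

Lemma enorm_sub_continuous x : continuous (fun y : 'rV[R]_n => enorm (y - x)).
Proof.
move=> y; apply: (@continuous_comp _ _ _ (fun y => y - x) (@enorm R n)).
  by apply: (@cvgB _ _ _ (nbhs y) _ id (fun=> x) y x); [exact: cvg_id|exact: cvg_cst].
exact: enorm_continuous.
Qed.

Lemma open_eball x (r : R) : open (eball x r).
Proof.
apply: (@open_comp _ _ (fun y => enorm (y - x)) [set t | t < r]).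
  by move=> y _; exact: enorm_sub_continuous.
exact: open_lt.
Qed.

Lemma measurable_eball x (r : R) : measurable (eball x r).
Proof. by apply: open_measurable_rV; exact: open_eball. Qed.

Definition ball_volume : R := fine (lebn n (eball 0 1)).

Lemma eball1_cbox : eball (0 : 'rV[R]_n) 1 `<=` cbox 0 1.
Proof.
move=> y; rewrite /eball /= subr0 => h i; rewrite mxE subr0.
by rewrite (le_trans (coord_le_enorm _ _))// ltW.
Qed.

Lemma le_lebn (A B : set 'rV[R]_n) : measurable A -> measurable B -> A `<=` B ->
  (lebn n A <= lebn n B)%E.
Proof. by move=> mA mB; apply: le_measure; rewrite inE. Qed.

Lemma ball_volumeE : lebn n (eball 0 1) = ball_volume%:E.
Proof.
rewrite /ball_volume fineK// ge0_fin_numE//.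
apply: le_lt_trans (le_lebn (measurable_eball _ _) (measurable_cbox _ _) eball1_cbox) _.
by rewrite lebn_cbox ?ltry.
Qed.

Lemma ball_volume_gt0 : 0 < ball_volume.
Proof.
(* With this half-side the squared Euclidean norm on the cube is at most [n * r ^+ 2], which is less
   than 1 also when [n = 0]. *)
rewrite -lte_fin -ball_volumeE; pose r : R := n.+1%:R^-1.
have r0 : 0 < r by rewrite invr_gt0.
apply: (@lt_le_trans _ _ (lebn n (cbox 0 r))).
  by rewrite lebn_cbox ?ltW// lte_fin exprn_gt0// pmulrn_rgt0.
apply: le_lebn; [exact: measurable_cbox|exact: measurable_eball|].
move=> y hy; rewrite /eball /= subr0.
rewrite -(@ltr_pXn2r _ 2)// ?nnegrE ?enorm_ge0// sqr_enorm expr1n.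
apply: (@le_lt_trans _ _ (\sum_(i < n) r ^+ 2)).
  apply: ler_sum => i _; rewrite -expr2 -real_normK ?num_real// ler_pXn2r ?nnegrE ?(ltW r0)//.
  by have := hy i; rewrite mxE subr0.
rewrite sumr_const card_ord -mulr_natr /r exprVn -[X in X < _]mulrC ltr_pdivrMr ?exprn_gt0//.
by rewrite mul1r -natrX ltr_nat -mulnn; exact: leq_pmulr.
Qed.

Lemma posdef_scalar (a : R) : 0 < a -> posdef (a%:M : 'M[R]_n).
Proof.
move=> a0; rewrite -[a%:M]add0r; apply: possemidefD_scalar => //.
by split; [rewrite trmx0|move=> x; rewrite /qform mulmx0 mul0mx mxE].
Qed.

Lemma lebn_eball x (r : R) : 0 < r -> lebn n (eball x r) = (r ^+ n * ball_volume)%:E.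
Proof.
move=> r0; have [_ /(_ _ (measurable_eball x r)) <-] := scales_translation x.
have [_ h] := scales_posdef (posdef_scalar r0).
rewrite mul1e -h; last by apply: measurable_preimage (measurable_eball x r); exact: (scales_translation x).1.
rewrite det_scalar EFinM -ball_volumeE; congr (_ * lebn n _)%E.
apply/seteqP; split => y; rewrite /eball /preimage /= mul_mx_scalar addrK enormZ subr0 gtr0_norm//.
  by rewrite -[X in _ < X -> _]mulr1 ltr_pM2l.
by rewrite -[X in _ -> _ < X]mulr1 ltr_pM2l.
Qed.

(** The covering argument works only for slopes strictly below [alpha]; this passes to the full
    radius. *)
Lemma pow_le_left_limit (a b c : R) m : 0 < a -> (forall t, 0 < t < a -> t ^+ m * b <= c) ->
  a ^+ m * b <= c.
Proof.
move=> a0 h; rewrite leNgt; apply/negP => ca.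
have cont : {for a, continuous (fun t : R => t ^+ m * b)}.
  by apply: cvgM; [exact: exprn_continuous|exact: cvg_cst].
have : \forall t \near a, c < t ^+ m * b by exact: cvgr_gt cont _ ca.
move=> /nbhs_ballP[e /= e0 he].
pose t := a - Num.min (e / 2) (a / 2).
have m0 : 0 < Num.min (e / 2) (a / 2) by rewrite lt_min !divr_gt0.
have ma : Num.min (e / 2) (a / 2) <= a / 2 by rewrite ge_min lexx orbT.
have me : Num.min (e / 2) (a / 2) <= e / 2 by rewrite ge_min lexx.
have := he t; rewrite /ball/= /t opprB addrC subrK gtr0_norm// => /(_ _).
have t0 : 0 < t < a by rewrite /t; apply/andP; split; lra.
by have := h t t0; rewrite /t; move=> h1 /(_ ltac:(lra)); rewrite ltNge h1.
Qed.

Lemma cvg_det (T : Type) (F : set_system T) (FF : Filter F) (M : T -> 'M[R]_n) (A : 'M[R]_n) :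
  (forall i j, (fun t => M t i j) @ F --> A i j) -> (fun t => \det (M t)) @ F --> \det A.
Proof.
move=> h; rewrite /determinant; apply: cvg_big => [|s _]; first exact: add_continuous.
apply: cvgM; first exact: cvg_cst.
by apply: cvg_big => [|i _]; [exact: mul_continuous|exact: h].
Qed.

End balls.

(** * Local constancy and connectedness *)

Section locally_constant.
Context {R : realType} {n : nat}.
Variables (Om : set 'rV[R]_n) (Om_open : open Om) (Om_connected : connected Om).

Lemma connected_clopen_sub (B : set 'rV[R]_n) : B `<=` Om -> B !=set0 -> open B ->
  open (Om `\` B) -> B = Om.
Proof.
move=> BO B0 oB oOB; apply: Om_connected => //.
  by exists B => //; apply/seteqP; split => x; [move=> Bx; split => //; exact: BO|case].
exists (~` (Om `\` B)); first exact: open_closedC.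
apply/seteqP; split => x; first by move=> Bx; split; [exact: BO|case].
by move=> [Ox nOB]; apply: contrapT => nBx; exact: nOB.
Qed.

Lemma locally_constant_connected (f : 'rV[R]_n -> R) :
  (forall x, Om x -> \forall y \near x, f y = f x) -> forall x y, Om x -> Om y -> f x = f y.
Proof.
move=> lf x y Ox Oy.
suff E : [set z | Om z /\ f z = f x] = Om by move: Oy; rewrite -E => -[_ ->].
apply: connected_clopen_sub; first by move=> z [].
- by exists x.
- rewrite openE => z [Oz zx]; rewrite /interior.
  have Oz' : \forall w \near z, Om w by exact: open_nbhs_nbhs.
  near=> w; split; first by near: w.
  by rewrite -zx; near: w; exact: lf.
- rewrite openE => z [Oz zx]; rewrite /interior.
  have Oz' : \forall w \near z, Om w by exact: open_nbhs_nbhs.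
  near=> w; split; first by near: w.
  move=> [_ wx]; apply: zx; split => //; rewrite -wx; apply/esym.
  by near: w; exact: lf.
Unshelve. all: by end_near.
Qed.

Lemma mix_cbox (x y : 'rV[R]_n) r k : 0 <= r -> cbox x r y -> cbox x r (mix x y k).
Proof. by move=> r0 xy i; rewrite mxE; case: ifP => // _; rewrite subrr normr0. Qed.

Lemma zero_gradient_locally_constant (f : 'rV[R]_n -> R) :
  (forall x, Om x -> strict_gradient f x 0) -> forall x, Om x -> \forall y \near x, f y = f x.
Proof.
move=> gf x Ox; have df z v : Om z -> is_derive z v f 0.
  by move=> Oz; have := strict_gradient_derive v (gf z Oz); rewrite dotv0.
have /nbhs_cboxP[r r0 hr] : nbhs x Om by exact: open_nbhs_nbhs.
have r2 : 0 < r / 2 by rewrite divr_gt0.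
apply/nbhs_cboxP; exists (r / 2) => // y xy /=; apply/eqP; rewrite -subr_eq0 telescope_mix.
apply/eqP/big1 => k _.
have inO s : `|s| <= `|y 0 k - x 0 k| -> Om (mix x y k + s *: delta_mx 0 k).
  move=> hs; apply: hr => i; have := mix_cbox k (ltW r2) xy i; have := xy k.
  move: hs; move: (mix x y k) => m; rewrite !mxE eqxx/=.
  have [->|_] := eqVneq i k; rewrite ?mulr1 ?mulr0 ?addr0; last by lra.
  move=> h1 h2 h3; rewrite addrAC (le_trans (ler_normD _ _))//; lra.
have [|s hs ->] := @line_MVT_signed _ _ f (mix x y k) (delta_mx 0 k) (y 0 k - x 0 k).
  by move=> s hs; have [] := df _ (delta_mx 0 k) (inO s hs).
by have [_ ->] := df _ (delta_mx 0 k) (inO s hs); rewrite mulr0.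
Qed.

Variables (u : 'rV[R]_n -> R) (u_C2 : Ck 2 Om u) (hn : (2 <= n)%N).

(** Formally $\partial_j\lambda = \partial_i\partial_j\partial_i u = 0$ for some $i \ne j$, but [u]
    has only two derivatives. Instead, the vanishing mixed derivative makes [partial i u] invariant
    under the shift by [t] in direction [j], so its derivative in direction [i], which is [lam], is
    invariant too. The choice of [i] needs two dimensions. *)
Lemma scalar_hess_laplacian_shift (W : set 'rV[R]_n) (lam : 'rV[R]_n -> R) (rho t : R) (j : 'I_n) y :
  0 < rho -> W `<=` Om -> (forall z, W z -> hess u z = (lam z)%:M) ->
  (forall z s, cbox y rho z -> `|s| <= `|t| -> W (z + s *: delta_mx 0 j)) ->
  lam (y + t *: delta_mx 0 j) = lam y.
Proof.
move=> rho0 WO hW seg.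
have [i ij] : exists i : 'I_n, i != j.
  have [<-|nj] := eqVneq (Ordinal (ltnW hn)) j; last by exists (Ordinal (ltnW hn)).
  by exists (Ordinal hn).
have lamE z : W z -> lam z = partial i (partial i u) z.
  by move=> Wz; have := congr1 (fun M : 'M[R]_n => M i i) (hW z Wz); rewrite !mxE eqxx mulr1n.
have lam0 z : W z -> partial j (partial i u) z = 0.
  move=> Wz; have := congr1 (fun M : 'M[R]_n => M j i) (hW z Wz).
  by rewrite !mxE eq_sym (negbTE ij) mulr0n.
have dW z v : W z -> is_derive z v (partial i u) ('D_v (partial i u) z).
  by move=> /WO Oz; have [h _] := Ck1_is_derive Om_open v (Ck2_partial i u_C2) Oz; split.
have y_rho : cbox y rho y by exact/cbox_center/ltW.
have Wt : W (y + t *: delta_mx 0 j) by exact: seg.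
have Wy : W y by have := seg y 0 y_rho; rewrite scale0r addr0 normr0; exact.
rewrite (lamE _ Wt) (lamE _ Wy).
change ('D_(delta_mx 0 i) (partial i u) (y + t *: delta_mx 0 j) =
  'D_(delta_mx 0 i) (partial i u) y).
have [d1 _] := dW _ (delta_mx 0 i) Wt.
have [_ <-] := is_derive_translate d1.
apply: near_eq_derive.
apply/nbhs_cboxP; exists rho => // z yz /=.
apply/eqP; rewrite -subr_eq0; apply/eqP.
have [|s hs ->] := @line_MVT_signed _ _ (partial i u) z (delta_mx 0 j) t.
  by move=> s hs; have [] := dW _ (delta_mx 0 j) (seg z s yz hs).
by rewrite -/(partial j (partial i u) _) lam0 ?mulr0//; exact: seg.
Qed.

Lemma scalar_hess_locally_constant (lam : 'rV[R]_n -> R) x :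
  (\forall z \near x, Om z /\ hess u z = (lam z)%:M) -> \forall y \near x, lam y = lam x.
Proof.
move=> /nbhs_cboxP[r r0 hr].
have r4 : 0 < r / 4 by rewrite divr_gt0.
apply/nbhs_cboxP; exists (r / 4) => // y xy /=; apply/eqP; rewrite -subr_eq0 telescope_mix.
apply/eqP/big1 => k _; apply/eqP; rewrite subr_eq0; apply/eqP.
(* The corner [mix], the cube around it and the shift each use up at most [r / 4]. *)
apply: (@scalar_hess_laplacian_shift (cbox x r) lam (r / 4)) => //.
- by move=> z /hr[].
- by move=> z /hr[].
- move=> z s hz hs i; have := mix_cbox k (ltW r4) xy i; have := xy k; have := hz i; move: hs.
  move: (mix x y k) => m; rewrite !mxE eqxx/=.
  have [->|_] := eqVneq i k; rewrite ?mulr1 ?mulr0 ?addr0 => hs h1 h2 h3.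
    have := ler_distD (m 0 k) (z 0 k) (x 0 k); rewrite addrAC.
    by move=> h4; rewrite (le_trans (ler_normD _ _))//; lra.
  by have := ler_distD (m 0 i) (z 0 i) (x 0 i); lra.
Qed.

End locally_constant.

Lemma cvg_sum_ord (R : realType) n (T : Type) (F : set_system T) (FF : Filter F)
    (h : 'I_n -> T -> R) (l : 'I_n -> R) :
  (forall i, h i @ F --> l i) -> (fun t => \sum_i h i t) @ F --> \sum_i l i.
Proof. by move=> hl; apply: cvg_big => // ; exact: add_continuous. Qed.

Lemma cvg_near_neq (R : realType) (T : Type) (F : set_system T) (FF : Filter F)
    (f : T -> R) (l c : R) : f @ F --> l -> l != c -> \forall t \near F, f t != c.
Proof.
move=> fl; rewrite neq_lt => /orP[lc|cl].
  have h : \forall t \near F, f t < c by exact: cvgr_lt fl _ lc.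
  by apply: filterS h => t /lt_eqF ->.
have h : \forall t \near F, c < f t by exact: cvgr_gt fl _ cl.
by apply: filterS h => t /gt_eqF ->.
Qed.

(** * The equality case *)

Section equality_case.
Context {R : realType} {n : nat}.
Variables (hn : (2 <= n)%N).
Variables (Om : set 'rV[R]_n) (u : 'rV[R]_n -> R) (Du nu : 'rV[R]_n -> 'rV[R]_n).
Hypotheses (Om_open : open Om) (Om_bounded : bounded_set Om) (Om_nonempty : Om !=set0).
Hypothesis Om_connected : connected Om.
Hypotheses (u_C2 : Ck 2 Om u) (u_C1 : C1_closure Om u Du).
Hypothesis nu_normal : outward_unit_normal Om nu.
Variable alpha : R.
Hypothesis alpha_gt0 : 0 < alpha.
Hypothesis u_nu : forall x, boundary Om x -> alpha <= normal_derivative Du nu x.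
Hypothesis u_eq : Lp_norm n%:R Om (laplacian u) =
  ((n%:R * alpha)%:E * (lebn n (eball 0 1%R)) `^ (n%:R^-1))%E.
Implicit Types x y v p : 'rV[R]_n.

(** * The lower contact set and its gradient image *)

Definition contact x := forall y, closure Om y -> u x + dotv (Du x) (y - x) <= u y.

(** Formed on the closure with the extended gradient [Du], so that it is closed; the cut at a slope
    [b] below [alpha] then keeps it away from the boundary. *)
Definition contact_set (b : R) := [set x | [/\ closure Om x, contact x & enorm (Du x) <= b]].

Lemma Du_grad x : Om x -> Du x = grad u x.
Proof. by have [_ _ _ h] := u_C1; exact: h. Qed.

Lemma boundary_closure x : closure Om x -> ~ Om x -> boundary Om x.
Proof. by move=> cx nOx; split => // ix; apply: nOx; exact: interior_subset. Qed.

Lemma contact_set_sub b : b < alpha -> contact_set b `<=` Om.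
Proof.
move=> ba x [cx _ xb]; apply: contrapT => nOx.
have bx := boundary_closure cx nOx.
have := u_nu bx; rewrite /normal_derivative leNgt => /negP; apply.
apply: le_lt_trans (dotv_le_enorm _ _) (le_lt_trans xb ba).
by have [] := nu_normal bx.
Qed.

Lemma closed_sublevel (f : 'rV[R]_n -> R) c : {within closure Om, continuous f} ->
  closed [set x | closure Om x /\ f x <= c].
Proof.
move=> /within_continuousP cf x xS.
have cx : closure Om x.
  by apply: closed_closure; move=> B /xS[y [[cy _] By]]; exists y.
split => //; rewrite leNgt; apply/negP => fc.
have : \forall y \near within (closure Om) (nbhs x), c < f y by exact: cvgr_gt (cf _ cx) _ fc.
move=> /xS[y [[cy fy] /(_ cy)]]; by rewrite ltNge fy.
Qed.

Lemma closed_contact_set b : 0 <= b -> closed (contact_set b).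
Proof.
move=> b0; have [_ cu cDu _] := u_C1.
rewrite (_ : contact_set b = closure Om `&`
  (\bigcap_(y in closure Om) [set x | closure Om x /\ u x + dotv (Du x) (y - x) - u y <= 0]) `&`
  [set x | closure Om x /\ dotv (Du x) (Du x) <= b ^+ 2]); last first.
  apply/seteqP; split => [x [cx ct xb]|x [[cx ct] [_ xb]]].
    split; first by split => // y cy; split => //; rewrite subr_le0; exact: ct.
    by split => //; rewrite -sqr_enorm ler_pXn2r ?nnegrE ?enorm_ge0.
  split => // [y cy|]; first by rewrite -subr_le0; exact: (ct y cy).2.
  by move: xb; rewrite -sqr_enorm ler_pXn2r ?nnegrE ?enorm_ge0.
refine (closedI (closedI (@closed_closure _ _) _) _).
- apply: closed_bigI => y _; apply: closed_sublevel; apply/within_continuousP => x cx.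
  apply: cvgB; last exact: cvg_cst.
  apply: cvgD; first by move/within_continuousP : cu; exact.
  apply: cvg_dotv; first by move/within_continuousP : cDu; exact.
  by apply: cvgB; [exact: cvg_cst|exact: cvg_within_id].
- apply: closed_sublevel; apply/within_continuousP => x cx.
  by apply: cvg_dotv; move/within_continuousP : cDu; exact.
Qed.

Lemma bounded_cbox : exists2 M, 0 <= M & Om `<=` cbox 0 M.
Proof.
have [w Ow] := Om_nonempty; have PF := globally_properfilter Ow.
have /ex_bound[M hM] := Om_bounded.
exists (Num.max M 0) => [|x Ox i]; first by rewrite le_max lexx orbT.
rewrite mxE subr0; apply: (rV_norm_leP x _).1; first by rewrite le_max lexx orbT.
by rewrite le_max; apply/orP; left; exact: hM.
Qed.

Lemma compact_closure : compact (closure Om).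
Proof.
apply: bounded_closed_compact; last exact: closed_closure.
have [M M0 OmM] := bounded_cbox.
have [w Ow] := Om_nonempty; have PF := globally_properfilter (subset_closure Ow).
apply/ex_bound; exists M => x cx /=; apply/rV_norm_leP => // i.
suff : cbox 0 M x by move=> /(_ i); rewrite mxE subr0.
by apply: closed_cbox => B /cx [y [Oy By]]; exists y; split => //; exact: OmM.
Qed.

(** At a boundary minimum [x] of [u - p], moving inwards along [- nu x] would lower the value: by
    continuity of [Du] up to the boundary, its component along [nu x] still exceeds that of [p] near
    [x]. The mean value theorem on the inward segment needs derivatives only at its interior points,
    which lie in [Om]. *)
Lemma contact_set_covers b p : b < alpha -> enorm p <= b -> exists2 x, contact_set b x & Du x = p.
Proof.
move=> ba pb; have [_ cu cDu _] := u_C1.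
have ne : closure Om !=set0 by have [y Oy] := Om_nonempty; exists y; exact: subset_closure.
have cv : {within closure Om, continuous (fun y => u y - dotv p y)}.
  apply/within_continuousP => x cx; apply: cvgB; first by move/within_continuousP : cu; exact.
  by apply: cvg_dotv; [exact: cvg_cst|exact: cvg_within_id].
have [x] := compact_EVT_min ne compact_closure cv.
rewrite inE => cx xmin'.
have xmin y : closure Om y -> u x + dotv p (y - x) <= u y.
  by move=> cy; have := xmin' y (mem_set cy); rewrite dotvDr dotvNr; lra.
have [Ox|nOx] := pselect (Om x).
  have [gp _] := minimum_second_order Om_open u_C2 Ox (fun y Oy => xmin y (subset_closure Oy)).
  by exists x; rewrite ?Du_grad//; split; rewrite /contact ?Du_grad ?gp.
exfalso.
have bx := boundary_closure cx nOx.
set v := nu x; have [v1 vN] := nu_normal bx; rewrite -/v in v1 vN.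
have pv : dotv p v < alpha.
  exact: le_lt_trans (dotv_le_enorm _ v1) (le_lt_trans pb ba).
have Dv : dotv p v < dotv (Du x) v by apply: lt_le_trans pv _; exact: u_nu.
(* For [e = 1] the inner cone reduces, by Cauchy-Schwarz, to the ray spanned by [- v], which is all
   that is needed. *)
have /nbhs_cboxP[r1 r1_gt0 hr1] := vN 1 ltr01.
have : \forall y \near within (closure Om) (nbhs x), dotv p v < dotv (Du y) v.
  have cD : (fun y => dotv (Du y) v) @ within (closure Om) (nbhs x) --> dotv (Du x) v.
    by apply: cvg_dotv; [move/within_continuousP : cDu; exact|exact: cvg_cst].
  exact: cvgr_gt cD _ Dv.
move=> /nbhs_cboxP[r2 r2_gt0 hr2].
have v0 : v != 0.
  by apply/eqP => v0; move: v1; rewrite v0 /enorm -(scale0r 0) dotvZl mul0r sqrtr0 => /esym/eqP; rewrite oner_eq0.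
have inO s : 0 < s <= r1 -> Om (x + s *: (- v)).
  move=> /andP[s0 sr]; have hs : cbox 0 r1 (s *: - v).
    move=> i; rewrite !mxE subr0 normrM normrN (gtr0_norm s0).
    apply: le_trans sr; rewrite ler_piMr ?(ltW s0)// -v1; exact: coord_le_enorm.
  have [|h _] := hr1 _ hs; first by rewrite scaler_eq0 oppr_eq0 negb_or v0 gt_eqF.
  apply: h; rewrite mul1r enormZ dotvZl dotvNl -[- v]scaleN1r enormZ v1 normrN1 gtr0_norm// -sqr_enorm v1.
    by rewrite !mulr1 expr1n mulrN1.
pose t := Num.min r1 r2.
have t0 : 0 < t by rewrite lt_min r1_gt0.
have tr1 : t <= r1 by rewrite ge_min lexx.
have tr2 : t <= r2 by rewrite ge_min lexx orbT.
have inC s : 0 <= s <= t -> closure Om (x + s *: - v).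
  rewrite le_eqVlt => /andP[/predU1P[<- _|s0 st]]; first by rewrite scale0r addr0.
  by apply: subset_closure; apply: inO; rewrite s0 (le_trans st).
have cline : {within `[0, t], continuous (fun s : R => u (x + s *: - v))}.
  apply/within_continuousP => s /=; rewrite in_itv/= => /inC cs.
  move/within_continuousP : cu => /(_ _ cs) cu N /cu /= uN.
  have : {for s, continuous (fun s : R => x + s *: - v)}.
    apply: cvgD; first exact: cvg_cst.
    by apply: (@cvgZr_tmp R 'rV[R]_n R (nbhs s) _ id s (- v)); exact: cvg_id.
  move=> /(_ _ uN) H.
  change (nbhs s [set w | `[0, t]%classic w -> N (u (x + w *: - v))]).
  change (nbhs s [set w | closure Om (x + w *: - v) -> N (u (x + w *: - v))]) in H.
  by apply: filterS H => w /= h; rewrite in_itv/= => /inC; exact: h.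
have [|s /andP[s0 st] E] := line_MVT t0 _ cline.
  move=> s /andP[s0 st].
  have Os : Om (x + s *: - v) by apply: inO; rewrite s0 (le_trans (ltW st)).
  by have [] := Ck1_is_derive Om_open (- v) (Ck2_Ck1 u_C2) Os.
have Os : Om (x + s *: - v) by apply: inO; rewrite s0 (le_trans (ltW st)).
have [_ DE] := Ck1_is_derive Om_open (- v) (Ck2_Ck1 u_C2) Os.
have t01 : 0 <= t <= t by rewrite (ltW t0) lexx.
have := xmin _ (inC t t01).
rewrite -lerBrDl E DE [x + t *: _]addrC addrK dotvZr ler_pM2l//.
rewrite dotvNr dotvNl lerN2 -Du_grad// dotvC leNgt => /negP; apply.
apply: hr2; last exact: subset_closure.
move=> i; rewrite !mxE [x 0 i + _]addrC addrK normrM normrN (gtr0_norm s0).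
apply: le_trans (_ : s <= r2); last exact: le_trans (ltW st) tr2.
rewrite ler_piMr ?(ltW s0)// -v1; exact: coord_le_enorm.
Qed.

(** * The integral estimate and its equality case *)

Let n_gt0 : 0 < n%:R :> R. Proof. by rewrite ltr0n ltnW. Qed.

(** The arithmetic-geometric mean bound for the Hessian determinant at contact points. The norm
    hypothesis says that its integral over [Om] is the volume of the ball of radius [alpha]. *)
Definition abp_density x := (`|laplacian u x| / n%:R) ^+ n.

Let f := abp_density \_ Om.

Lemma abp_density_ge0 x : 0 <= abp_density x.
Proof. by rewrite exprn_ge0// divr_ge0// ltW. Qed.

Let f_ge0 x : 0 <= f x.
Proof. by rewrite /f patchE; case: ifP => _; rewrite ?abp_density_ge0. Qed.

Let fE x : Om x -> f x = abp_density x.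
Proof. by move=> Ox; rewrite /f patchE mem_set. Qed.

Lemma continuous_hess x i j : Om x -> {for x, continuous (fun y => hess u y i j)}.
Proof.
move=> Ox; rewrite (_ : (fun y => _) = partial i (partial j u)); last first.
  by apply/funext => y; rewrite mxE.
by have [_ /(_ j)[_ [_ /(_ i)[_ [h _]]]]] := u_C2; exact: h.
Qed.

Lemma continuous_laplacian x : Om x -> {for x, continuous (laplacian u)}.
Proof.
move=> Ox; apply: (@cvg_sum_ord R n _ (nbhs x) _ (fun i => partial i (partial i u))) => i.
by have [_ /(_ i)[_ [_ /(_ i)[_ [h _]]]]] := u_C2; exact: h.
Qed.

Lemma continuous_abp_density x : Om x -> {for x, continuous abp_density}.
Proof.
move=> Ox; apply: (@continuous_comp _ _ _ (fun y => `|laplacian u y| / n%:R) (fun t => t ^+ n)).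
  apply: (@cvgM _ _ (nbhs x) _ (fun y => `|laplacian u y|) (fun=> n%:R^-1)); last exact: cvg_cst.
  by apply: (@continuous_comp _ _ _ (laplacian u) Num.norm); [exact: continuous_laplacian|exact: norm_continuous].
exact: exprn_continuous.
Qed.

Lemma continuous_det_hess x : Om x -> {for x, continuous (fun y => \det (hess u y))}.
Proof. by move=> Ox; apply: (@cvg_det R n _ (nbhs x) _ (hess u) (hess u x)) => i j; exact: continuous_hess. Qed.

Let measurable_f : measurable_fun setT f.
Proof.
apply/(measurable_restrictT _ (open_measurable_rV Om_open)).
by apply: measurable_fun_open_continuous => // x; exact: continuous_abp_density.
Qed.

Lemma integral_abp_density : (\int[lebn n]_x (f x)%:E = (alpha ^+ n * @ball_volume R n)%:E)%E.
Proof.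
have n0 : n%:R != 0 :> R by rewrite gt_eqF.
have := congr1 (fun z => poweR z n%:R) u_eq; rewrite /Lp_norm poweR_Lnorm//.
rewrite poweRM ?poweR_ge0// ?lee_fin ?mulr_ge0// ?(ltW alpha_gt0) ?(ltW n_gt0)//.
rewrite -poweRrM mulVf// poweRe1// ball_volumeE poweR_EFin powR_mulrn ?mulr_ge0 ?(ltW alpha_gt0) ?(ltW n_gt0)//.
rewrite (eq_integral (fun x => (n%:R ^+ n)%:E * (f x)%:E)%E); last first.
  move=> x _; rewrite /f !patchE; case: ifP => _ /=; last first.
    by rewrite normr0 powR0 ?mule0.
  rewrite powR_mulrn// -EFinM /abp_density -exprMn mulrC divfK//.
have mfE : measurable_fun setT (fun x => (f x)%:E) by exact/measurable_EFinP.
have f0E x : setT x -> (0 <= (f x)%:E)%E by rewrite lee_fin.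
have nn0 : (0 <= (n%:R ^+ n)%:E :> \bar R)%E by rewrite lee_fin exprn_ge0// ltW.
rewrite ge0_integralZl//.
rewrite -EFinM exprMn -mulrA EFinM => /(congr1 (fun z => ((n%:R ^+ n)^-1)%:E * z)%E).
rewrite !muleA -!EFinM mulVf ?expf_neq0// !mul1e mul1r//.
Qed.

Let contact_possemidef x : Om x -> contact x -> possemidef (hess u x).
Proof.
move=> Ox cx; have [|//] := @minimum_second_order R n Om Om_open u x (Du x) u_C2 Ox.
by move=> y Oy; apply: cx; exact: subset_closure.
Qed.

Lemma det_hess_le x : Om x -> contact x -> \det (hess u x) <= abp_density x.
Proof.
move=> Ox cx; have pH := contact_possemidef Ox cx.
have [d0|d0] := eqVneq (\det (hess u x)) 0; first by rewrite d0 abp_density_ge0.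
have [h _] := det_le_AGM (possemidef_posdef pH d0).
rewrite (le_trans h)// mxtrace_hess /abp_density.
by rewrite (le_trans (ler_norm _))// normrX normrM [`|n%:R^-1|]gtr0_norm ?invr_gt0.
Qed.

(** Kept general in [g], and demanding a bound at contact points only, so that it can be applied to
    functions smaller than the density. *)
Lemma ball_le_integral (g : 'rV[R]_n -> R) : (forall x, 0 <= g x) -> measurable_fun setT g ->
  (forall x, Om x -> contact x -> exists m, [/\ 0 <= m, \det (hess u x) <= m &
      forall eta, 0 < eta -> \forall y \near x, m - eta <= g y]) ->
  (forall b, 0 < b < alpha -> ((b ^+ n * @ball_volume R n)%:E <= \int[lebn n]_x (g x)%:E)%E).
Proof.
move=> g0 mg hg b /andP[b0 ba].
rewrite -(lebn_eball 0 b0) -lebn_outerE; last exact: measurable_eball.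
have [M M0 OmM] := bounded_cbox.
pose a : 'rV[R]_n := const_mx (- M).
apply: (@le_trans _ _ (lebn_outer (grad u @` contact_set b))).
  apply: le_lebn_outer => p; rewrite /eball /= subr0 => pb.
  have [x Kx xp] := contact_set_covers ba (ltW pb).
  exists x => //; rewrite -xp Du_grad//.
  exact: (contact_set_sub ba Kx).
(* The extra 1 is there because [qcube] omits its upper faces. *)
apply: (@image_measure_le _ _ _ _ g a (M *+ 2 + 1)) => //.
- by rewrite ltr_wpDl// mulrn_wge0.
- exact: (closed_contact_set (ltW b0)).
- move=> x /(contact_set_sub ba)/OmM hx i.
  by have := hx i; rewrite !mxE subr0 ler_norml => /andP[? ?]; apply/andP; split; lra.
- move=> x Kx; have Ox := contact_set_sub ba Kx.
  have [_ cx _] := Kx; have [m [m0 dm gm]] := hg x Ox cx.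
  exists (hess u x), m; split => //; first exact: (grad_strict_derivative Om_open).
  exact: contact_possemidef.
Qed.

(* Otherwise ball_le_integral would apply to the density lowered by eta on the
   cube, whose integral is too small. *)
Lemma no_slack (x : 'rV[R]_n) (r eta : R) : 0 < r -> 0 < eta -> cbox x r `<=` Om ->
  (forall y, cbox x r y -> eta <= abp_density y) ->
  ~ (forall y, cbox x r y -> contact y -> \det (hess u y) <= abp_density y - eta).
Proof.
move=> r0 eta0 NO Nf Nd.
pose N := cbox x r; have mN : measurable N := measurable_cbox x r.
pose g y := f y - eta * \1_N y.
have gN y : N y -> g y = abp_density y - eta.
  by move=> Ny; rewrite /g (fE (NO _ Ny)) indicE mem_set// mulr1.
have gnN y : ~ N y -> g y = f y.
  by move=> Ny; rewrite /g indicE memNset// mulr0 subr0.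
have g0 y : 0 <= g y.
  by have [Ny|Ny] := pselect (N y); [rewrite gN// subr_ge0 Nf|rewrite gnN].
have m1 : measurable_fun setT (fun y : 'rV[R]_n => eta * \1_N y).
  by apply: measurable_funM => //; exact: measurable_indic.
have mg : measurable_fun setT g by apply: measurable_funB.
have int_g : (\int[lebn n]_y (g y)%:E + (eta * (r *+ 2) ^+ n)%:E = (alpha ^+ n * @ball_volume R n)%:E)%E.
  rewrite -integral_abp_density.
  transitivity (\int[lebn n]_y ((g y)%:E + (eta * \1_N y)%:E))%E; last first.
    by apply: eq_integral => y _; rewrite -EFinD subrK.
  rewrite ge0_integralD//; [|by move=> *; rewrite lee_fin|exact/measurable_EFinP|
    by move=> *; rewrite lee_fin mulr_ge0// ltW|exact/measurable_EFinP].
  congr (_ + _)%E; under eq_integral do rewrite EFinM.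
  rewrite ge0_integralZl//; [|by apply/measurable_EFinP; exact: measurable_indic|by rewrite lee_fin ltW].
  rewrite integral_indic// setIT EFinM; congr (_ * _)%E.
  by apply/esym; exact: (lebn_cbox x (ltW r0)).
(* Since [N] is closed, subtracting a multiple of its indicator preserves lower semicontinuity: off
   [N] nothing changes nearby, and on [N] the full [eta] has already been subtracted. *)
have le_g b : 0 < b < alpha -> ((b ^+ n * @ball_volume R n)%:E <= \int[lebn n]_x (g x)%:E)%E.
  apply: ball_le_integral => // y Oy cy.
  have fy e : 0 < e -> \forall z \near y, abp_density y - e <= abp_density z.
    move=> e0; have : \forall z \near y, abp_density y - e < abp_density z.
      by apply: cvgr_gt (continuous_abp_density Oy) _ _; rewrite gtrBl.
    by apply: filterS => z /ltW.
  have Oy' : \forall z \near y, Om z by exact: open_nbhs_nbhs.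
  have [Ny|Ny] := pselect (N y).
    exists (abp_density y - eta); split; [by rewrite subr_ge0 Nf|exact: Nd|].
    move=> e e0; near=> z.
    have h1 : abp_density y - e <= abp_density z by near: z; exact: fy.
    have h2 : Om z by near: z.
    rewrite /g fE//; have : \1_N z <= 1 :> R by rewrite indicE; case: (_ \in _).
    by move=> h3; rewrite addrAC lerB// ler_piMr// ltW.
  exists (abp_density y); split; [exact: abp_density_ge0|exact: det_hess_le|].
  move=> e e0; near=> z.
  have h1 : abp_density y - e <= abp_density z by near: z; exact: fy.
  have h2 : Om z by near: z.
  have h3 : ~ N z.
    near: z; apply: open_nbhs_nbhs; split => //; apply: closed_openC; exact: closed_cbox.
  by rewrite gnN// fE.
have finG : (\int[lebn n]_y (g y)%:E \is a fin_num)%E.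
  rewrite ge0_fin_numE; last by apply: integral_ge0 => *; rewrite lee_fin.
  apply: (@le_lt_trans _ _ (alpha ^+ n * @ball_volume R n)%:E); last exact: ltry.
  by rewrite -int_g leeDl// lee_fin mulr_ge0 ?ltW// exprn_gt0// pmulrn_rgt0.
have : alpha ^+ n * @ball_volume R n <= fine (\int[lebn n]_y (g y)%:E).
  by apply: (pow_le_left_limit alpha_gt0) => t /le_g; rewrite -lee_fin fineK.
rewrite -lee_fin fineK// -int_g -[X in (_ <= X)%E -> _]adde0 leeD2lE// lee_fin.
by rewrite leNgt mulr_gt0// exprn_gt0// pmulrn_rgt0.
Unshelve. all: by end_near.
Qed.

Let Fnear x (c : R) : Om x -> c < abp_density x -> \forall z \near x, c < abp_density z.
Proof.
by move=> Ox cF; exact: cvgr_gt (continuous_abp_density Ox) _ cF.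
Qed.

(** Failure of contact at [x] is witnessed by a fixed [y] and persists near [x] by continuity. A
    small cube then has no contact point, the determinant condition of [no_slack] is vacuous, and
    the density could be lowered there. *)
Lemma contact_of_density_gt0 x : Om x -> 0 < abp_density x -> contact x.
Proof.
move=> Ox F0; apply: contrapT => nc.
have [y [cy uy]] : exists y, closure Om y /\ u y < u x + dotv (Du x) (y - x).
  apply: contrapT => h; apply: nc => y cy; rewrite leNgt; apply/negP => uy.
  by apply: h; exists y.
have F2 : abp_density x / 2 < abp_density x by rewrite ltr_pdivrMr// ltr_pMr// ltr1n.
have e0 : 0 < abp_density x / 2 by rewrite divr_gt0.
have cdot : (fun z => u z + dotv (grad u z) (y - z)) @ x --> u x + dotv (grad u x) (y - x).
  apply: (@cvgD _ _ _ (nbhs x) _ u (fun z => dotv (grad u z) (y - z))).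
    by have [h _] := u_C2; exact: h.
  apply: (@cvg_sum_ord R n _ (nbhs x) _ (fun i z => grad u z 0 i * (y - z) 0 i)) => i.
  apply: (@cvgM _ _ (nbhs x) _ (fun z => grad u z 0 i) (fun z => (y - z) 0 i)).
    rewrite (_ : (fun z => _) = partial i u); last by apply/funext => z; rewrite mxE.
    by rewrite mxE; have [_ /(_ i)[_ [h _]]] := Ck2_Ck1 u_C2; exact: h.
  rewrite (_ : (fun z : 'rV[R]_n => (y - z) 0 i) = (fun z : 'rV[R]_n => y 0 i - z 0 i)); last first.
    by apply/funext => z; rewrite !mxE.
  rewrite [(y - x) 0 i]mxE [(- x : 'rV_n) 0 i]mxE.
  apply: (@cvgB _ _ _ (nbhs x) _ (fun=> y 0 i) (fun z : 'rV[R]_n => z 0 i)); first exact: cvg_cst.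
  exact: coord_continuous.
have : \forall z \near x, u y < u z + dotv (grad u z) (y - z).
  by apply: cvgr_gt cdot _ _; rewrite -Du_grad.
move=> /nbhs_cboxP[r1 r10 hr1].
have /nbhs_cboxP[r2 r20 hr2] := Fnear Ox F2.
have /nbhs_cboxP[r3 r30 hr3] : nbhs x Om by exact: open_nbhs_nbhs.
pose r := Num.min r1 (Num.min r2 r3).
have r0 : 0 < r by rewrite !lt_min r10 r20.
have le z s : r <= s -> cbox x r z -> cbox x s z by move=> rs h i; exact: le_trans (h i) rs.
apply: (@no_slack x r (abp_density x / 2) r0 e0).
- by move=> z /le zr; apply/hr3/zr; rewrite !ge_min lexx !orbT.
- by move=> z /le zr; apply/ltW/hr2/zr; rewrite !ge_min lexx !orbT.
- move=> z /le zr cz; exfalso.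
  have Oz : Om z by apply/hr3/zr; rewrite !ge_min lexx !orbT.
  have zr1 : cbox x r1 z by apply: zr; rewrite ge_min lexx.
  by have := hr1 z zr1; rewrite /= -Du_grad// ltNge (cz y cy).
Qed.

Lemma det_of_density_gt0 x : Om x -> 0 < abp_density x -> abp_density x <= \det (hess u x).
Proof.
move=> Ox F0; rewrite leNgt; apply/negP => dF.
(* Below both the density and its gap to the determinant, hence still below both on a small cube. *)
pose eta := Num.min (abp_density x) (abp_density x - \det (hess u x)) / 2.
have m0 : 0 < Num.min (abp_density x) (abp_density x - \det (hess u x)) by rewrite lt_min F0 subr_gt0.
have e0 : 0 < eta by rewrite divr_gt0.
have eta_lt : eta < Num.min (abp_density x) (abp_density x - \det (hess u x)).
  by rewrite ltr_pdivrMr// ltr_pMr// ltr1n.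
move: (eta_lt); rewrite lt_min => /andP[e1 e2].
have /nbhs_cboxP[r2 r20 hr2] := Fnear Ox e1.
have cd : (fun z => abp_density z - \det (hess u z)) @ x --> abp_density x - \det (hess u x).
  apply: (@cvgB _ _ _ (nbhs x) _ abp_density (fun z => \det (hess u z))).
    exact: continuous_abp_density.
  exact: continuous_det_hess.
have : \forall z \near x, eta < abp_density z - \det (hess u z) by exact: cvgr_gt cd _ e2.
move=> /nbhs_cboxP[r1 r10 hr1].
have /nbhs_cboxP[r3 r30 hr3] : nbhs x Om by exact: open_nbhs_nbhs.
pose r := Num.min r1 (Num.min r2 r3).
have r0 : 0 < r by rewrite !lt_min r10 r20.
have le z s : r <= s -> cbox x r z -> cbox x s z by move=> rs h i; exact: le_trans (h i) rs.
apply: (@no_slack x r eta r0 e0).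
- by move=> z /le zr; apply/hr3/zr; rewrite !ge_min lexx !orbT.
- by move=> z /le zr; apply/ltW/hr2/zr; rewrite !ge_min lexx !orbT.
- move=> z /le zr _; have : eta < abp_density z - \det (hess u z).
    by apply/hr1/zr; rewrite ge_min lexx.
  by move=> /ltW; rewrite lerBrDr addrC -lerBrDr.
Qed.

Lemma density_gt0 x : laplacian u x != 0 -> 0 < abp_density x.
Proof. by move=> lx; rewrite exprn_gt0// divr_gt0// normr_gt0. Qed.

(** The contact property gives a semidefinite Hessian and the positive determinant makes it
    definite. The trace is then positive, which removes the absolute value in the density, and
    equality in [det_le_AGM] applies. *)
Lemma scalar_hess x : Om x -> laplacian u x != 0 ->
  0 < laplacian u x /\ hess u x = (laplacian u x / n%:R)%:M.
Proof.
move=> Ox /density_gt0 F0; have dF := det_of_density_gt0 Ox F0.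
have cx := contact_of_density_gt0 Ox F0.
have [_ psd] : grad u x = Du x /\ possemidef (hess u x).
  exact: (minimum_second_order Om_open u_C2 Ox (fun y Oy => cx y (subset_closure Oy))).
have pd := possemidef_posdef psd (lt0r_neq0 (lt_le_trans F0 dF)).
have lp : 0 < laplacian u x.
  rewrite -mxtrace_hess /mxtrace (bigD1 (Ordinal hn))//= ltr_wpDr ?posdef_diag_gt0//.
  by apply: sumr_ge0 => i _; apply/ltW/posdef_diag_gt0.
split => //; have [_] := det_le_AGM pd; rewrite mxtrace_hess; apply.
by move: dF; rewrite /abp_density gtr0_norm.
Qed.

Lemma exists_laplacian_neq0 : exists2 x, Om x & laplacian u x != 0.
Proof.
apply: contrapT => h.
have l0 x : Om x -> laplacian u x = 0.
  by move=> Ox; apply/eqP; apply: contrapT => /negP lx; apply: h; exists x.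
have := integral_abp_density.
rewrite (eq_integral (fun=> 0%E)); last first.
  move=> x _; rewrite /f patchE; case: ifPn => //; rewrite inE => /l0 lx.
  by rewrite /abp_density lx normr0 mul0r expr0n; case: (n) hn.
rewrite integral0 => -[] /esym/eqP; rewrite gt_eqF// mulr_gt0 ?exprn_gt0//.
exact: ball_volume_gt0.
Qed.

Lemma laplacian_constant : exists2 lam : R, 0 < lam &
  forall x, Om x -> laplacian u x = n%:R * lam /\ hess u x = lam%:M.
Proof.
have [x0 Ox0 l0] := exists_laplacian_neq0.
have [c c0 x0c] : exists2 c, 0 < c & laplacian u x0 = c.
  by exists (laplacian u x0); have [] := scalar_hess Ox0 l0.
exists (c / n%:R); first by rewrite divr_gt0.
suff E : [set x | Om x /\ laplacian u x = c] = Om.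
  have nc : n%:R * (c / n%:R) = c by rewrite mulrC divfK// (gt_eqF n_gt0).
  move=> x; rewrite -{1}E nc => -[Ox lx]; split; first exact: lx.
  have lx0 : laplacian u x != 0 by rewrite lx (gt_eqF c0).
  by have [_ ->] := scalar_hess Ox lx0; rewrite lx.
have nearO z : Om z -> \forall w \near z, Om w by move=> Oz; exact: open_nbhs_nbhs.
apply: (connected_clopen_sub Om_connected); first by move=> z [].
- by exists x0.
- rewrite openE => z [Oz zc]; rewrite /interior.
  have lam_const : \forall w \near z, laplacian u w / n%:R = laplacian u z / n%:R.
    apply: (@scalar_hess_locally_constant R n Om Om_open u u_C2 hn (fun w => laplacian u w / n%:R)).
    have lw : \forall w \near z, 0 < laplacian u w.
      by apply: cvgr_gt (continuous_laplacian Oz) _ _; rewrite zc.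
    have Ow := nearO z Oz.
    near=> w; split; first by near: w.
    have Ow' : Om w by near: w.
    have lw0 : laplacian u w != 0 by apply: lt0r_neq0; near: w.
    by have [_ h] := scalar_hess Ow' lw0; exact: h.
  have Ow := nearO z Oz.
  near=> w; split; first by near: w.
  apply: (mulIf (x := n%:R^-1)); first by rewrite invr_neq0// gt_eqF.
  by rewrite -zc; near: w.
- rewrite openE => z [Oz zc]; rewrite /interior.
  have Ow := nearO z Oz.
  have lz : laplacian u z != c by apply/eqP => lz; apply: zc.
  have lw : \forall w \near z, laplacian u w != c.
    have lc : laplacian u @ z --> laplacian u z := continuous_laplacian Oz.
    exact: cvg_near_neq lc lz.
  near=> w; split; first by near: w.
  by move=> [_ /eqP]; apply/negP; near: w.
Unshelve. all: by end_near.
Qed.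

(** * The quadratic polynomial and the ball *)

Variable lam : R.
Hypothesis lam_gt0 : 0 < lam.
Hypothesis lap_lam : forall x, Om x -> laplacian u x = n%:R * lam /\ hess u x = lam%:M.

Lemma grad_affine : exists x0, forall x, Om x -> grad u x = lam *: (x - x0).
Proof.
have [w Ow] := Om_nonempty.
(* The centre is forced by the formula at the base point [w]. *)
exists (w - lam^-1 *: grad u w) => x Ox; apply/rowP => i.
pose phi (z : 'rV[R]_n) := partial i u z - lam * z 0 i.
have fc : phi x = phi w.
  apply: (locally_constant_connected Om_open Om_connected) => //.
  apply: zero_gradient_locally_constant => // z Oz d d0.
  have [r r0 hr] := Ck1_strict_gradient Om_open (Ck2_partial i u_C2) Oz d0.
  exists r => // a y rho rho0 za zy ay; have := hr a y rho rho0 za zy ay.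
  have -> : grad (partial i u) z = lam *: delta_mx 0 i.
    apply/rowP => j; have [_ /(congr1 (fun M : 'M[R]_n => M j i))] := lap_lam Oz.
    by rewrite !mxE eqxx/= => ->; rewrite mulr_natr.
  rewrite dotvZr (dotvC _ (delta_mx 0 i)) dotv_delta.
  rewrite dotv0; congr (`| _ | <= _); rewrite /phi !mxE; ring.
move: fc; rewrite /phi !mxE => h.
apply: (@eq_trans _ _ (lam * x 0 i - lam * w 0 i + partial i u w)); first by move: h; lra.
by field; rewrite gt_eqF.
Qed.

Variable x0 : 'rV[R]_n.
Hypothesis grad_x0 : forall x, Om x -> grad u x = lam *: (x - x0).

Lemma quadratic_on_domain : exists c1, forall x, Om x -> u x = lam / 2 * dotv (x - x0) (x - x0) + c1.
Proof.
have [w Ow] := Om_nonempty.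
pose phi (z : 'rV[R]_n) := u z - lam / 2 * dotv (z - x0) (z - x0).
exists (phi w) => x Ox; suff <- : phi x = phi w by rewrite /phi addrC subrK.
apply: (locally_constant_connected Om_open Om_connected) => //.
apply: zero_gradient_locally_constant => // z Oz d d0.
have d2 : 0 < d / 2 by rewrite divr_gt0.
have [r r0 hr] := Ck1_strict_gradient Om_open (Ck2_Ck1 u_C2) Oz d2.
pose s := d / 2 / (lam * n%:R).
have s0 : 0 < s by rewrite divr_gt0// mulr_gt0.
exists (Num.min r s) => [|a y rho rho0 za zy ay]; first by rewrite lt_min r0.
have zar : cbox z r a by move=> i; rewrite (le_trans (za i))// ge_min lexx.
have zyr : cbox z r y by move=> i; rewrite (le_trans (zy i))// ge_min lexx.
have := hr a y rho rho0 zar zyr ay; rewrite grad_x0// dotvZr => h1.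
rewrite dotv0 subr0.
(* This is $|y-z|^2 - |a-z|^2$, the nonlinear part at [z] of the increment of the square. The radius
   [s] is chosen so that [lam / 2] times it is at most [d / 2 * rho]. *)
pose q := dotv (y - a) ((a - z) + (y - z)).
have hq : `|q| <= rho * (n%:R * (s *+ 2)).
  have yac : cbox 0 rho (y - a) by move=> i; have := ay i; rewrite !mxE subr0.
  apply: le_trans (dotv_cbox _ yac) _; apply: ler_wpM2l => //.
  rewrite mulr_natl -[n in X in _ <= X]card_ord -sumr_const; apply: ler_sum => i _.
  have h2 : `|a 0 i - z 0 i| <= s by rewrite (le_trans (za i))// ge_min lexx orbT.
  have h3 : `|y 0 i - z 0 i| <= s by rewrite (le_trans (zy i))// ge_min lexx orbT.
  by rewrite !mxE mulr2n (le_trans (ler_normD _ _))// lerD.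
have -> : phi y - phi a = (u y - u a - lam * dotv (y - a) (z - x0)) - lam / 2 * q.
  rewrite /q; have -> : y - a = (y - z) - (a - z) by rewrite opprB subrKA.
  have Ey : y - x0 = (y - z) + (z - x0) by rewrite subrKA.
  have Ea : a - x0 = (a - z) + (z - x0) by rewrite subrKA.
  rewrite /phi Ey Ea; move: (y - z) (a - z) (z - x0) => Y A X.
  rewrite !(dotvDl, dotvDr, dotvNl) (dotvC A Y) (dotvC X Y) (dotvC X A); by field.
apply: le_trans (ler_normB _ _) _.
rewrite [`|lam / 2 * q|]normrM gtr0_norm; last by rewrite divr_gt0.
have h4 : lam / 2 * `|q| <= d / 2 * rho.
  have -> : d / 2 * rho = lam / 2 * (rho * (n%:R * (s *+ 2))).
    by rewrite /s; field; rewrite !gt_eqF.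
  by rewrite ler_pM2l// divr_gt0.
by rewrite (le_trans (lerD h1 h4))//; lra.
Qed.

Lemma quadratic_on_closure c1 : (forall x, Om x -> u x = lam / 2 * dotv (x - x0) (x - x0) + c1) ->
  forall x, closure Om x -> u x = lam / 2 * dotv (x - x0) (x - x0) + c1.
Proof.
move=> uO x cx; pose g z := u z - lam / 2 * dotv (z - x0) (z - x0).
have cg : {within closure Om, continuous g}.
  have [_ /within_continuousP cu _ _] := u_C1.
  apply/within_continuousP => z cz.
  apply: (@cvgB _ _ _ (within (closure Om) (nbhs z)) _ u (fun z => lam / 2 * dotv (z - x0) (z - x0))).
    exact: cu.
  apply: (@cvgM _ _ (within (closure Om) (nbhs z)) _ (fun=> lam / 2) (fun z => dotv (z - x0) (z - x0))).
    exact: cvg_cst.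
  by apply: cvg_dotv; (apply: cvgB; [exact: cvg_within_id|exact: cvg_cst]).
have cNg : {within closure Om, continuous (fun z => - g z)}.
  apply/within_continuousP => z cz; apply: cvgN.
  by move/within_continuousP : cg; exact.
have gO z : Om z -> g z = c1 by move=> Oz; rewrite /g uO// addrC addKr.
have [_ h1] : [set x | closure Om x /\ g x <= c1] x.
  apply: (closed_sublevel cg) => B /cx [y [Oy By]]; exists y; split => //.
  by split; [exact: subset_closure|rewrite gO].
have [_ h2] : [set x | closure Om x /\ - g x <= - c1] x.
  apply: (closed_sublevel cNg) => B /cx [y [Oy By]]; exists y; split => //.
  by split; [exact: subset_closure|rewrite gO].
have : g x = c1 by apply/eqP; rewrite eq_le h1 -lerN2.
by rewrite /g => <-; rewrite addrC subrK.
Qed.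

(** The slope [lam *: (y - x0)] has norm below [alpha], so it is the gradient at some point of [Om];
    the gradient formula identifies that point with [y]. *)
Lemma eball_sub_domain : eball x0 (alpha / lam) `<=` Om.
Proof.
move=> y; rewrite /eball /= => yr.
have pb : enorm (lam *: (y - x0)) < alpha.
  by rewrite enormZ gtr0_norm// mulrC -ltr_pdivlMr.
have [x Kx Dx] := contact_set_covers pb (lexx _).
have Ox := contact_set_sub pb Kx.
move: Dx; rewrite Du_grad// grad_x0// => /(scalerI (lt0r_neq0 lam_gt0)).
by move=> /(addIr (- x0)) <-.
Qed.

(** The density is the constant [lam ^+ n] on [Om], so its known integral determines the volume. *)
Lemma lebn_domain : lebn n Om = lebn n (eball x0 (alpha / lam)).
Proof.
have := integral_abp_density.
rewrite (eq_integral (fun x => (lam ^+ n)%:E * (\1_Om x)%:E)%E); last first.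
  move=> x _; rewrite /f patchE indicE; case: ifPn => [|_]; last by rewrite mulr0n mule0.
  rewrite inE => /lap_lam[lx _]; rewrite /abp_density lx /= mulr1n mule1.
  by rewrite gtr0_norm ?mulr_gt0// [n%:R * lam]mulrC mulfK// gt_eqF.
have mO := open_measurable_rV Om_open.
have m1 : measurable_fun setT (fun x => (\1_Om x : R)%:E).
  by apply/measurable_EFinP; exact: measurable_indic.
have l0 : (0 <= (lam ^+ n)%:E :> \bar R)%E by rewrite lee_fin exprn_ge0// ltW.
rewrite ge0_integralZl// integral_indic// setIT => E.
have -> : lebn n Om = (((lam ^+ n)^-1)%:E * ((lam ^+ n)%:E * lebn n Om))%E.
  by rewrite muleA -EFinM mulVf ?mul1e// gt_eqF// exprn_gt0.
rewrite [X in (_ * X)%E]E lebn_eball ?divr_gt0// -EFinM; congr EFin.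
by rewrite expr_div_n mulrA [_^-1 * _]mulrC.
Qed.

(** Equal measure alone would allow a null set outside the ball. A point of [Om] on or beyond the
    sphere can be pushed radially outwards within the open set [Om], and a small cube around the new
    point adds positive measure to that of the ball. *)
Lemma domain_sub_eball : Om `<=` eball x0 (alpha / lam).
Proof.
move=> y Oy; rewrite /eball /= ltNge; apply/negP => ry.
have r0 : 0 < alpha / lam by rewrite divr_gt0.
have e0 : 0 < enorm (y - x0) by exact: lt_le_trans ry.
have /nbhs_cboxP[s s0 hs] : nbhs y Om by exact: open_nbhs_nbhs.
(* The displacement then has Euclidean length [s], so the moved point stays in the cube of half-side
   [s] around [y]. *)
pose t := s / enorm (y - x0).
have t0 : 0 < t by rewrite divr_gt0.
pose z := y + t *: (y - x0).
have Oz : Om z.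
  apply: hs => i; rewrite /z mxE [y 0 i + _]addrC addrK mxE normrM (gtr0_norm t0).
  by rewrite /t mulrAC ler_pdivrMr// ler_pM2l// coord_le_enorm.
have zr : alpha / lam < enorm (z - x0).
  rewrite /z addrAC -{1}[y - x0]scale1r -scalerDl enormZ gtr0_norm ?addr_gt0//.
  by rewrite mulrDl mul1r (le_lt_trans ry)// ltrDl mulr_gt0.
have ez := @enorm_sub_continuous R n x0 z.
have : \forall w \near z, alpha / lam < enorm (w - x0) by exact: cvgr_gt ez _ zr.
move=> /nbhs_cboxP[s1 s10 hs1].
have /nbhs_cboxP[s2 s20 hs2] : nbhs z Om by exact: open_nbhs_nbhs.
pose q := Num.min s1 s2; have q0 : 0 < q by rewrite lt_min s10.
pose B := eball x0 (alpha / lam); pose N := cbox z q.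
have mB : measurable B by exact: measurable_eball.
have mN : measurable N by exact: measurable_cbox.
have BN : B `&` N = set0.
  rewrite -subset0 => w [Bw Nw].
  have : alpha / lam < enorm (w - x0) by apply: hs1 => i; rewrite (le_trans (Nw i))// ge_min lexx.
  by rewrite ltNge ltW.
have sub : B `|` N `<=` Om.
  move=> w [/eball_sub_domain//|Nw]; apply: hs2 => i.
  by rewrite (le_trans (Nw i))// ge_min lexx orbT.
have le := le_lebn (measurableU _ _ mB mN) (open_measurable_rV Om_open) sub.
have E : (lebn n (B `|` N) = lebn n B + lebn n N)%E by exact: measureU.
move: le; rewrite E lebn_domain /B lebn_eball// /N lebn_cbox ?(ltW q0)// -EFinD lee_fin.
by rewrite gerDl leNgt exprn_gt0// pmulrn_rgt0.
Qed.

End equality_case.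

Theorem corollary2p7 (R : realType) (n : nat) (hn : (2 <= n)%N)
  (Om : set 'rV[R]_n) (Om_open : open Om) (Om_bounded : bounded_set Om)
  (Om_nonempty : Om !=set0) (Om_connected : connected Om)
  (nu : 'rV[R]_n -> 'rV[R]_n) (nu_normal : outward_unit_normal Om nu)
  (u : 'rV[R]_n -> R) (Du : 'rV[R]_n -> 'rV[R]_n)
  (u_C2 : Ck 2 Om u) (u_C1 : C1_closure Om u Du)
  (alpha : R) (alpha_gt0 : 0 < alpha)
  (u_nu : forall x, boundary Om x -> alpha <= normal_derivative Du nu x)
  (u_eq : Lp_norm n%:R Om (laplacian u) =
          ((n%:R * alpha)%:E * (lebn n (eball 0 1%R)) `^ (n%:R^-1))%E) :
  exists (c0 c1 : R) (x0 : 'rV[R]_n),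
    (forall x, closure Om x -> u x = c0 * enorm (x - x0) ^+ 2 + c1) /\
    exists2 r : R, 0 < r & Om = eball x0 r.
Proof.
have [lam lam0 hlam] := laplacian_constant hn Om_open Om_bounded Om_nonempty Om_connected
  u_C2 u_C1 nu_normal alpha_gt0 u_nu u_eq.
have [x0 gx0] := grad_affine Om_open Om_nonempty Om_connected u_C2 lam0 hlam.
have [c1 uO] := quadratic_on_domain hn Om_open Om_nonempty Om_connected u_C2 lam0 gx0.
exists (lam / 2), c1, x0; split.
  by move=> x cx; rewrite sqr_enorm; apply: (quadratic_on_closure u_C1 uO).
exists (alpha / lam); first exact: divr_gt0.
apply/seteqP; split.
  exact: (domain_sub_eball hn Om_open Om_bounded Om_nonempty u_C2 u_C1 nu_normal alpha_gt0 u_nu u_eq lam0 hlam gx0).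
exact: (eball_sub_domain Om_open Om_bounded Om_nonempty u_C2 u_C1 nu_normal u_nu lam0 gx0).
Qed.
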